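(* Let $\beta\in\{1,2\}$. For any $\theta>0$ and any $\kappa\in(0,1/2)$, there exists a function $g_\kappa:\mathbb{R}_+\to\mathbb{R}_+$ with $g_\kappa(\delta)\to0$ as $\delta\to0$ such that the following holds. For any $\delta>0$ and any sequences $(B_N)_{N\ge1}$, $(B_N')_{N\ge1}$ of $N\times N$ matrices (real symmetric if $\beta=1$, complex Hermitian if $\beta=2$) with $\sup_N\|B_N\|_\infty<\infty$ and $\sup_N\|B_N'\|_\infty<\infty$, for all $N$ large enough: if $$d(\hat\nu_{B_N},\hat\nu_{B_N'})\le N^{-\kappa}\quad\text{and}\quad|\lambda_1(B_N)-\lambda_1(B_N')|\le\delta,$$ then $$\left|\frac1N\log I_N^\beta(\theta,B_N)-\frac1N\log I_N^\beta(\theta,B_N')\right|\le g_\kappa(\delta).$$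
   Context: For an $N\times N$ matrix $B_N$ (real symmetric if $\beta=1$, complex Hermitian if $\beta=2$), $\lambda_1(B_N)\ge\cdots\ge\lambda_N(B_N)$ are its eigenvalues in decreasing order, $\hat\nu_{B_N}:=\frac1N\sum_{i=2}^N\delta_{\lambda_i(B_N)}$, and $\|B_N\|_\infty:=\max(|\lambda_1(B_N)|,|\lambda_N(B_N)|)$. The Dudley distance is $$d(\mu,\nu)=\sup\left\{\left|\int f\,d\mu-\int f\,d\nu\right|\;:\;|f(x)|\le1\text{ and }\left|\frac{f(x)-f(y)}{x-y}\right|\le1\ \ \forall x\ne y\right\}.$$ The (rank one) spherical integral is $$I_N^\beta(\theta,B_N)=\int e^{N\theta\,(UB_NU^* )_{11}}\,dm_N^\beta(U),$$ where $m_N^\beta$ is the Haar probability measure on the orthogonal group $\mathcal{O}_N$ if $\beta=1$ and on the unitary group $\mathcal{U}_N$ if $\beta=2$. *)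

(* Defs.v *)
From HB Require Import structures.
From mathcomp Require Import all_boot all_order all_algebra.
From mathcomp Require Import sesquilinear spectral complex.
From mathcomp Require Import all_classical all_reals all_analysis.

Set Implicit Arguments.
Unset Strict Implicit.
Unset Printing Implicit Defensive.

Import Order.TTheory GRing.Theory Num.Theory numFieldNormedType.Exports.

Local Open Scope classical_set_scope.
Local Open Scope ring_scope.
Local Open Scope complex_scope.
Local Open Scope sesquilinear_scope.

(* Matrices of both symmetry classes are complex matrices of size n.+1 (so that
   the entry of index ord0 makes sense); when beta = 1 all their entries are
   required to be real. *)
Section defs.
Context {R : realType}.

(* Real symmetric if beta = 1, complex Hermitian if beta = 2. *)
Definition self_adjoint (beta n : nat) (B : 'M[R[i]]_n.+1) : bool :=
  (B \is hermsymmx) && ((beta == 1%N) ==> (B \is a realmx)).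

(* The orthogonal group if beta = 1, the unitary group if beta = 2. *)
Definition isom_group (beta n : nat) : set 'M[R[i]]_n.+1 :=
  [set U | (U \is unitarymx) && ((beta == 1%N) ==> (U \is a realmx))].
Arguments isom_group beta n _ : clear implicits.

(* The roots of the characteristic polynomial, listed with multiplicity; [Re]
   only transports them from R[i] to R, since they are real for the matrices
   considered. *)
Definition spectrum (n : nat) (B : 'M[R[i]]_n.+1) : seq R :=
  sort (fun x y => y <= x)
    [seq complex.Re z | z <- sval (closed_field_poly_normal (char_poly B))].

(* Indexing starts at 0: [eigval B 0] is lambda_1 and [eigval B n] is lambda_N,
   where N = n.+1. *)
Definition eigval (n : nat) (B : 'M[R[i]]_n.+1) (i : nat) : R :=
  nth 0 (spectrum B) i.

Definition norm_oo (n : nat) (B : 'M[R[i]]_n.+1) : R :=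
  Num.max `|eigval B 0| `|eigval B n|.

(* The weight is 1/N although only the N - 1 = n eigenvalues lambda_2, ...,
   lambda_N are charged. *)
Definition nu_hat (n : nat) (B : 'M[R[i]]_n.+1) :
    {measure set (measurableTypeR R) -> \bar R} :=
  mscale ((n.+1%:R : R)^-1)%:nng (msum (fun i => \d_(eigval B i.+1 : measurableTypeR R)) n).

Definition dudley (mu nu : {measure set (measurableTypeR R) -> \bar R}) :
    \bar R :=
  ereal_sup
    [set `| \int[mu]_x (f x)%:E - \int[nu]_x (f x)%:E |%E | f in
      [set f : R -> R | (forall x, `|f x| <= 1) /\
        (forall x y, x != y -> `|(f x - f y) / (x - y)| <= 1)]].

(* The Borel sigma-algebra of the space of complex matrices; [R[i]^o] carries
   the topology of the modulus. *)
Definition borel_mx (n : nat) := g_sigma_algebraType (@open 'M[R[i]^o]_n.+1).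

(* The group being compact, its Haar probability measure is the Borel
   probability measure carried by the group that is invariant under its left
   and right translations. *)
Definition is_haar (beta n : nat) (m : probability (borel_mx n) R) : Prop :=
  m (isom_group beta n) = 1%E /\
  forall (V : 'M[R[i]]_n.+1) (A : set (borel_mx n)),
    isom_group beta n V -> measurable A ->
    m ((fun U : 'M[R[i]]_n.+1 => V *m U) @^-1` A) = m A /\
    m ((fun U : 'M[R[i]]_n.+1 => U *m V) @^-1` A) = m A.

(* The diagonal entry is real because B is self-adjoint. *)
Definition spherical_integral (beta n : nat) (m : probability (borel_mx n) R)
    (theta : R) (B : 'M[R[i]]_n.+1) : R :=
  \int[m]_(U in isom_group beta n)
    expR (n.+1%:R * theta *
      complex.Re (((U : 'M[R[i]]_n.+1) *m B *m (U : 'M[R[i]]_n.+1) ^t* ) ord0 ord0)).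

End defs.

Arguments borel_mx R n : clear implicits.
Arguments isom_group {R} beta n _.

(* Main.v *)
Require Import Defs.
From HB Require Import structures.
From mathcomp Require Import all_boot all_order all_algebra.
From mathcomp Require Import fingroup perm sesquilinear spectral complex.
From mathcomp Require Import all_classical all_reals all_analysis.
From mathcomp Require Import measurable_realfun zify ring lra.

(** By invariance of the Haar measure under right translations, the spherical
    integral only depends on the eigenvalues d_0 >= ... >= d_n of the matrix: it
    is the mean of exp (N theta (d_0 |u_0|^2 + ... + d_n |u_n|^2)), N = n + 1,
    where u is the first row of a Haar distributed matrix, a random unit vector.
    Its normalised logarithm [free_energy] is compared for two spectra through
    one principle, [free_energy_cover]: if a finite family of group elements V
    is such that every U has one V in the family with
    (U B U^t* )_00 <= (U V B' V^t* U^t* )_00 + c, then the free energy of B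
    exceeds that of B' by at most theta c plus 1/N times the logarithm of the
    size of the family.

    With a family of one element this shows that raising all the eigenvalues by
    at most c costs at most theta c ([diag_energy_mono]) and that the order of
    the eigenvalues is irrelevant ([diag_energy_perm]).  The essential case is
    [diag_energy_step]: replacing one eigenvalue by an arbitrary bounded value
    costs only O(log N / N), as long as the top eigenvalue d_0 is kept.  Indeed
    d_0 |u_0|^2 + d_j |u_j|^2 <= d_0 (|u_0|^2 + |u_j|^2), and a rotation of the
    plane (0, j) brings all the mass of (u_0, u_j) to the coordinate 0, after
    which the j-th eigenvalue no longer matters.  The rotation depends on u, but
    polynomially many rotations approximate all of them up to O(1/N).

    The Dudley distance e controls the counting functions of the two spectra at
    the scale h: with p about N e / h, lambda_(i+p)(B) <= lambda_i(B') + h for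
    all i >= 1, where lambda_0 is the top eigenvalue ([eigval_shift]).  After a
    cyclic shift by p, all the eigenvalues but p of them and the top one are thus
    ordered up to h; the p exceptional ones are replaced one at a time, and the
    top ones differ by at most delta.  In total the free energies differ by at
    most theta (delta + h) + (e / h) O(log N) ([free_energy_compare]).  For
    e = N^-kappa the last term vanishes as N grows, and h = min(delta, 1) gives
    g(delta) = (2 theta + 1) delta. *)

Set Implicit Arguments.
Unset Strict Implicit.
Unset Printing Implicit Defensive.

Import Order.TTheory GRing.Theory Num.Theory numFieldNormedType.Exports.

Local Open Scope classical_set_scope.
Local Open Scope ring_scope.
Local Open Scope complex_scope.
Local Open Scope sesquilinear_scope.

(** * Borel measurability on spaces of complex matrices *)

Section measurability.
Context {R : realType}.
Implicit Types n : nat.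

Lemma cvg_mx (T : Type) (F : set_system T) (FF : Filter F) n
    (f : T -> 'M[R[i]^o]_n.+1) (M : 'M[R[i]^o]_n.+1) :
  (forall i j, (fun x => f x i j : R[i]^o) @ F --> (M i j : R[i]^o)) -> f @ F --> M.
Proof.
move=> fM A [P MP PA].
have : \forall x \near F, forall ij : 'I_n.+1 * 'I_n.+1, P ij.1 ij.2 (f x ij.1 ij.2).
  by apply: filter_forall => -[i j]; exact: (fM i j).
apply: filterS => x H; apply: PA => i j; exact: (H (i, j)).
Qed.

Lemma continuous_mulmxr n (V : 'M[R[i]^o]_n.+1) :
  continuous (fun U : 'M[R[i]^o]_n.+1 => (U *m V : 'M[R[i]^o]_n.+1)).
Proof.
move=> U; apply: (@cvg_mx _ _ (nbhs_filter U)) => i j.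
under eq_fun do rewrite mxE.
rewrite mxE.
apply: cvg_big => [|k _]; first exact: add_continuous.
by apply: cvgM; [exact: coord_continuous | exact: cvg_cst].
Qed.

Lemma continuous_Re : continuous (fun z : R[i]^o => complex.Re z).
Proof.
move=> z A /nbhs_ballP[e /= e0 eA].
apply/(nbhs_ballP (z : R[i]^o)); exists (e%:C); first by rewrite /= ltcR.
move=> w; rewrite -ball_normE /= => zw; apply: eA.
rewrite -ball_normE /= -ltcR; apply: le_lt_trans zw.
by have := normc_ge_Re (z - w); rewrite raddfB.
Qed.

Lemma continuous_Im : continuous (fun z : R[i]^o => complex.Im z).
Proof.
move=> z A /nbhs_ballP[e /= e0 eA].
apply/(nbhs_ballP (z : R[i]^o)); exists (e%:C); first by rewrite /= ltcR.
move=> w; rewrite -ball_normE /= => zw; apply: eA.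
rewrite -ball_normE /= -ltcR; apply: le_lt_trans zw.
have := normc_ge_Re ((z - w) * 'i%C).
by rewrite ReiNIm normrM complexiE normCi mulr1 normrN raddfB.
Qed.

Lemma measurable_continuous_mx n (f : borel_mx R n -> R) :
  continuous (f : 'M[R[i]^o]_n.+1 -> R) -> measurable_fun setT f.
Proof.
move=> /continuousP cf; apply: (measurability _ (RGenOpens.measurableE R)).
move=> _ [_ [a [b ->] <-]]; rewrite setTI; apply: sub_sigma_algebra.
exact/cf/interval_open.
Qed.

Lemma measurable_Re_entry n (i j : 'I_n.+1) :
  measurable_fun setT (fun U : borel_mx R n => complex.Re ((U : 'M[R[i]]_n.+1) i j)).
Proof.
apply: measurable_continuous_mx => U.
apply: (@continuous_comp _ _ _ (fun U : 'M[R[i]^o]_n.+1 => U i j : R[i]^o)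
  (fun z : R[i]^o => complex.Re z)); [exact: coord_continuous | exact: continuous_Re].
Qed.

Lemma measurable_Im_entry n (i j : 'I_n.+1) :
  measurable_fun setT (fun U : borel_mx R n => complex.Im ((U : 'M[R[i]]_n.+1) i j)).
Proof.
apply: measurable_continuous_mx => U.
apply: (@continuous_comp _ _ _ (fun U : 'M[R[i]^o]_n.+1 => U i j : R[i]^o)
  (fun z : R[i]^o => complex.Im z)); [exact: coord_continuous | exact: continuous_Im].
Qed.

Lemma measurable_mulmxr n (V : 'M[R[i]]_n.+1) :
  measurable_fun setT (fun U : borel_mx R n => (U : 'M[R[i]]_n.+1) *m V : borel_mx R n).
Proof.
have E : @measurable _ (borel_mx R n) = <<s (@open 'M[R[i]^o]_n.+1) >> by [].
apply: (measurability _ E) => _ [A oA <-]; rewrite setTI.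
apply: sub_sigma_algebra.
by move/continuousP: (@continuous_mulmxr n V); exact.
Qed.

(** The polynomial expressions in the entries of a matrix and their conjugates
    that are needed here are handled through real-valued measurable functions,
    which avoids putting a measurable structure on the complex numbers. *)
Definition cmeasurable n (f : borel_mx R n -> R[i]) :=
  measurable_fun setT (fun U => complex.Re (f U)) /\
  measurable_fun setT (fun U => complex.Im (f U)).

Lemma cmeasurable_entry n (i j : 'I_n.+1) :
  cmeasurable (fun U : borel_mx R n => (U : 'M[R[i]]_n.+1) i j).
Proof. by split; [exact: measurable_Re_entry|exact: measurable_Im_entry]. Qed.

Lemma cmeasurable_cst n z : cmeasurable (fun _ : borel_mx R n => z).
Proof. by split; exact: measurable_cst. Qed.

Lemma Re_mulc (z w : R[i]) : complex.Re (z * w) =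
  complex.Re z * complex.Re w - complex.Im z * complex.Im w.
Proof. by case: z w => [a b] [c d]. Qed.

Lemma Im_mulc (z w : R[i]) : complex.Im (z * w) =
  complex.Re z * complex.Im w + complex.Im z * complex.Re w.
Proof. by case: z w => [a b] [c d]. Qed.

Lemma cmeasurableM n (f g : borel_mx R n -> R[i]) :
  cmeasurable f -> cmeasurable g -> cmeasurable (fun U => f U * g U).
Proof.
move=> [f1 f2] [g1 g2]; split.
  under eq_fun do rewrite Re_mulc.
  by apply: measurable_funB; apply: measurable_funM.
under eq_fun do rewrite Im_mulc.
by apply: measurable_funD; apply: measurable_funM.
Qed.

Lemma Re_conjc (z : R[i]) : complex.Re (conjc z) = complex.Re z.
Proof. by case: z. Qed.

Lemma Im_conjc (z : R[i]) : complex.Im (conjc z) = - complex.Im z.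
Proof. by case: z. Qed.

Lemma cmeasurable_conj n (f : borel_mx R n -> R[i]) :
  cmeasurable f -> cmeasurable (fun U => conjc (f U)).
Proof.
move=> [f1 f2]; split; first by under eq_fun do rewrite Re_conjc.
by under eq_fun do rewrite Im_conjc; apply: measurableT_comp f2.
Qed.

Lemma cmeasurable_sum n (I : Type) (r : seq I) (f : I -> borel_mx R n -> R[i]) :
  (forall i, cmeasurable (f i)) -> cmeasurable (fun U => \sum_(i <- r) f i U).
Proof.
move=> mf; split; under eq_fun do rewrite raddf_sum.
  by apply: (measurable_sum _ (h := fun i U => complex.Re (f i U))) => i; case: (mf i).
by apply: (measurable_sum _ (h := fun i U => complex.Im (f i U))) => i; case: (mf i).
Qed.

Lemma measurable_fiber n (f : borel_mx R n -> R) (c : R) :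
  measurable_fun setT f -> measurable [set U | f U = c].
Proof.
move=> mf; have := mf measurableT [set c] (measurable_set1 c).
by rewrite setTI.
Qed.

Lemma measurable_forall n (I : finType) (P : I -> set (borel_mx R n)) :
  (forall i, measurable (P i)) -> measurable [set U | forall i, P i U].
Proof.
move=> mP; rewrite (_ : [set _ | _] = \bigcap_(i in [set: I]) P i).
  by apply: fin_bigcap_measurable => // i _; exact: mP.
by apply/seteqP; split => U /= H i; [move=> _|]; exact: H.
Qed.

Lemma conj_conjc (z : R[i]) : Num.conj z = conjc z.
Proof. by []. Qed.

(** With B = 1 this also covers the equations defining the unitary group. *)
Lemma cmeasurable_conjugation_entry n (B : 'M[R[i]]_n.+1) i j :
  cmeasurable (fun U : borel_mx R n =>
    ((U : 'M[R[i]]_n.+1) *m B *m (U : 'M[R[i]]_n.+1) ^t* ) i j).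
Proof.
under eq_fun do rewrite mxE; apply: cmeasurable_sum => k.
apply: cmeasurableM.
  under eq_fun do rewrite mxE; apply: cmeasurable_sum => l.
  apply: cmeasurableM; [exact: cmeasurable_entry|exact: cmeasurable_cst].
under eq_fun do rewrite !mxE conj_conjc.
exact/cmeasurable_conj/cmeasurable_entry.
Qed.

Lemma measurable_isom_group beta n :
  measurable (isom_group beta n : set (borel_mx R n)).
Proof.
have mu : measurable [set U : borel_mx R n | (U : 'M[R[i]]_n.+1) \is unitarymx].
  rewrite (_ : [set _ | _] = [set U : borel_mx R n | forall ij : 'I_n.+1 * 'I_n.+1,
     complex.Re (((U : 'M[R[i]]_n.+1) *m 1%:M *m (U : 'M[R[i]]_n.+1) ^t* ) ij.1 ij.2)
       = complex.Re ((1%:M : 'M[R[i]]_n.+1) ij.1 ij.2) ] `&`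
    [set U : borel_mx R n | forall ij : 'I_n.+1 * 'I_n.+1,
     complex.Im (((U : 'M[R[i]]_n.+1) *m 1%:M *m (U : 'M[R[i]]_n.+1) ^t* ) ij.1 ij.2)
       = complex.Im ((1%:M : 'M[R[i]]_n.+1) ij.1 ij.2) ]).
    apply: measurableI; apply: measurable_forall => ij; apply: measurable_fiber;
      by case: (cmeasurable_conjugation_entry (1%:M : 'M[R[i]]_n.+1) ij.1 ij.2).
  apply/seteqP; split=> U /=; rewrite mulmx1.
    by move=> /unitarymxP ->.
  move=> [h1 h2]; apply/unitarymxP/matrixP => i j; apply/eqP.
  by rewrite eq_complex (h1 (i, j)) (h2 (i, j)) !eqxx.
rewrite /isom_group; have [b1|b1] := boolP (beta == 1%N) => /=; last first.
  by under eq_set do rewrite andbT.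
rewrite (_ : [set _ | _] = [set U : borel_mx R n | (U : 'M[R[i]]_n.+1) \is unitarymx] `&`
  [set U : borel_mx R n | forall ij : 'I_n.+1 * 'I_n.+1,
     complex.Im ((U : 'M[R[i]]_n.+1) ij.1 ij.2) = 0]).
  apply: measurableI => //; apply: measurable_forall => ij; apply: measurable_fiber.
  exact: measurable_Im_entry.
apply/seteqP; split=> U /=.
  move=> /andP[-> /mxOverP Ur]; split => // -[i j] /=.
  by have := Ur i j; case: (U i j) => a b; rewrite complex_real => /eqP.
move=> [-> Ur] /=; apply/mxOverP => i j.
by have := Ur (i, j) => /=; case: (U i j) => a b /= ->; rewrite complex_real.
Qed.

Definition corner n (B U : 'M[R[i]]_n.+1) : R := complex.Re ((U *m B *m U ^t* ) ord0 ord0).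

Lemma measurable_corner n (B : 'M[R[i]]_n.+1) :
  measurable_fun setT (fun U : borel_mx R n => corner B U).
Proof. by case: (cmeasurable_conjugation_entry B ord0 ord0). Qed.

End measurability.

(** * Haar integrals and comparison by finite families of translations *)

Section haar.
Context {R : realType} (beta n : nat) (m : probability (borel_mx R n) R).
Hypothesis hm : is_haar beta m.
Local Notation G := (isom_group beta n : set (borel_mx R n)).
Local Notation N := (n.+1%:R : R).

Lemma isom_group_mul (U V : 'M[R[i]]_n.+1) :
  isom_group beta n U -> isom_group beta n V -> isom_group beta n (U *m V).
Proof.
move=> /andP[Uu Ur] /andP[Vu Vr]; apply/andP; split.
  by rewrite mul_unitarymx.
by apply/implyP => b1; exact: (mxOverM (implyP Ur b1) (implyP Vr b1)).
Qed.

Lemma isom_group_conj (V : 'M[R[i]]_n.+1) :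
  isom_group beta n V -> isom_group beta n (V ^t* ).
Proof.
move=> /andP[Vu Vr]; apply/andP; split; first by rewrite trmxC_unitary.
apply/implyP => b1; rewrite b1 /= in Vr.
apply/mxOverP => i j; rewrite !mxE.
move/mxOverP: Vr => /(_ j i); rewrite conj_conjc.
by case: (V j i) => a b; rewrite !complex_real oppr_eq0.
Qed.

Lemma isom_groupK (V : 'M[R[i]]_n.+1) : isom_group beta n V -> V *m V ^t* = 1%:M.
Proof. by move=> /andP[/unitarymxP]. Qed.

Lemma isom_group_mulr (U V : 'M[R[i]]_n.+1) :
  isom_group beta n V -> isom_group beta n (U *m V) <-> isom_group beta n U.
Proof.
move=> VG; split => [UVG|UG]; last exact: isom_group_mul.
rewrite -[U]mulmx1 -(isom_groupK VG) mulmxA.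
exact: (isom_group_mul UVG (isom_group_conj VG)).
Qed.

(** Right invariance says that the push-forward of the measure is the measure
    itself, and the group is its own preimage. *)
Lemma haar_integral_mulr (V : 'M[R[i]]_n.+1) (f : borel_mx R n -> \bar R) :
  isom_group beta n V -> measurable_fun setT f -> (forall U, 0 <= f U)%E ->
  (\int[m]_(U in G) f ((U : 'M[R[i]]_n.+1) *m V) = \int[m]_(U in G) f U)%E.
Proof.
move=> VG mf f0.
pose phi := fun U : borel_mx R n => (U : 'M[R[i]]_n.+1) *m V : borel_mx R n.
have mphi : measurable_fun setT phi by exact: measurable_mulmxr.
have -> : (\int[m]_(U in G) f U = \int[pushforward m phi]_(U in G) f U)%E.
  apply: eq_measure_integral => A mA _.
  have [_ /= <-//] := (proj2 hm) V A VG mA.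
have GE : phi @^-1` G = G.
  apply/seteqP; split => U; first exact: (proj1 (isom_group_mulr U VG)).
  exact: (proj2 (isom_group_mulr U VG)).
have mG := @measurable_isom_group R beta n.
have fG : measurable_fun G f := measurable_funS measurableT (@subsetT _ _) mf.
have f0G : {in G, forall U, (0 <= f U)%E} by move=> U _; exact: f0.
by rewrite (ge0_integral_pushforward mphi m mG fG f0G) GE.
Qed.

(** The spherical integral before it is projected to the reals: comparing
    extended reals needs no integrability, and finiteness is itself obtained by
    comparison with the zero matrix. *)
Definition espherical (theta : R) (B : 'M[R[i]]_n.+1) : \bar R :=
  (\int[m]_(U in G) (expR (N * theta * corner B U))%:E)%E.

Lemma measurable_expR_corner theta (B : 'M[R[i]]_n.+1) D :
  measurable_fun D (fun U : borel_mx R n => (expR (N * theta * corner B U))%:E).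
Proof.
apply: (measurable_funS measurableT (@subsetT _ _)).
apply/measurable_EFinP; apply: measurableT_comp => //.
apply: measurable_funM => //; exact: measurable_corner.
Qed.

(** The maximum over the family is bounded by the sum, and each term of the sum
    has the integral of its untranslated version by invariance. *)
Lemma espherical_cover theta (B B' : 'M[R[i]]_n.+1) (c : R) (Vs : seq 'M[R[i]]_n.+1) :
  0 <= theta ->
  (forall V, V \in Vs -> isom_group beta n V) ->
  (forall U : 'M[R[i]]_n.+1, isom_group beta n U ->
     exists2 V, V \in Vs & corner B U <= corner B' (U *m V) + c) ->
  (espherical theta B <= ((size Vs)%:R * expR (N * theta * c))%:E * espherical theta B')%E.
Proof.
move=> t0 VsG cov.
pose f V (U : borel_mx R n) : \bar R :=
  (expR (N * theta * c) * expR (N * theta * corner B' ((U : 'M[R[i]]_n.+1) *m V)))%:E.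
have mf0 : measurable_fun setT (fun U : borel_mx R n =>
    (expR (N * theta * c) * expR (N * theta * corner B' U))%:E).
  apply/measurable_EFinP; apply: measurable_funM => //.
  by have /measurable_EFinP := @measurable_expR_corner theta B' setT.
have mf V : measurable_fun G (f V).
  apply: (measurable_funS measurableT (@subsetT _ _)).
  exact: (measurableT_comp mf0 (measurable_mulmxr V)).
have mG := @measurable_isom_group R beta n.
have f0 V U : (0 <= f V U)%E by rewrite lee_fin mulr_ge0 // expR_ge0.
apply: (@le_trans _ _ (\int[m]_(U in G) \sum_(V <- Vs) f V U)%E).
  apply: ge0_le_integral => //.
  - exact: measurable_expR_corner.
  - exact: emeasurable_sum.
  move=> U /cov[V VVs le]; rewrite (big_rem V) //=.
  apply: (@le_trans _ _ (f V U)); last by rewrite leeDl // sume_ge0.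
  rewrite lee_fin -expRD ler_expR -mulrDr ler_wpM2l //.
    by rewrite mulr_ge0.
  by rewrite addrC.
rewrite ge0_integral_sum //.
rewrite [leLHS](_ : _ = \sum_(V <- Vs) ((expR (N * theta * c))%:E * espherical theta B')%E).
  have sph0 : (0 <= (expR (N * theta * c))%:E * espherical theta B')%E.
    by rewrite mule_ge0 ?lee_fin ?expR_ge0 //; apply: integral_ge0 => U _; rewrite lee_fin expR_ge0.
  rewrite EFinM -muleA le_eqVlt; apply/orP; left; apply/eqP.
  elim: (Vs) => [|V s IH]; first by rewrite big_nil mul0e.
  by rewrite big_cons IH /= -(nat1r (size s)) EFinD ge0_muleDl ?lee_fin // mul1e.
apply: eq_big_seq => V /VsG VG.
rewrite /f (haar_integral_mulr (f := fun U =>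
  (expR (N * theta * c) * expR (N * theta * corner B' U))%:E)) //.
under eq_integral do rewrite EFinM.
rewrite ge0_integralZl_EFin ?expR_ge0 //.
exact: measurable_expR_corner.
Qed.

Definition corner_bounded (B : 'M[R[i]]_n.+1) :=
  exists c : R, forall U : 'M[R[i]]_n.+1, isom_group beta n U -> `|corner B U| <= c.

Lemma corner0 (U : 'M[R[i]]_n.+1) : corner 0 U = 0 :> R.
Proof. by rewrite /corner mulmx0 mul0mx mxE. Qed.

Lemma isom_group1 : isom_group beta n (1%:M : 'M[R[i]]_n.+1).
Proof.
apply/andP; split; first by apply/unitarymxP; rewrite trmx1 map_mx1 mulmx1.
apply/implyP => _; apply/mxOverP => i j; rewrite !mxE.
by case: eqP => _; rewrite ?rpred1 ?rpred0.
Qed.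

Lemma espherical0 theta : espherical theta 0 = 1%E.
Proof.
rewrite /espherical; under eq_integral do rewrite corner0 mulr0 expR0.
rewrite integral_cst; last exact: measurable_isom_group.
by rewrite mul1e; exact: (proj1 hm).
Qed.

Lemma espherical_fin_pos theta (B : 'M[R[i]]_n.+1) : 0 <= theta -> corner_bounded B ->
  exists2 r : R, 0 < r & espherical theta B = r%:E.
Proof.
move=> t0 [c Bc].
have in1 (V : 'M[R[i]]_n.+1) : V \in [:: (1%:M : 'M[R[i]]_n.+1)] -> isom_group beta n V.
  by rewrite inE => /eqP ->; exact: isom_group1.
have h1 : (espherical theta B <= ((size [:: (1%:M : 'M[R[i]]_n.+1)])%:R * expR (N * theta * c))%:E *
    espherical theta 0)%E.
  apply: espherical_cover => // U /Bc Uc; exists 1%:M; first by rewrite inE.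
  by rewrite corner0 add0r (le_trans _ Uc) // ler_norm.
have h2 : (espherical theta 0 <= ((size [:: (1%:M : 'M[R[i]]_n.+1)])%:R * expR (N * theta * c))%:E *
    espherical theta B)%E.
  apply: espherical_cover => // U /Bc Uc; exists 1%:M; first by rewrite inE.
  by rewrite corner0 mulmx1 -lerBlDr sub0r lerNl (le_trans _ Uc) // -normrN ler_norm.
rewrite !espherical0 /= !mul1r in h1 h2.
have e0 : (0 <= espherical theta B)%E.
  by apply: integral_ge0 => U _; rewrite lee_fin expR_ge0.
move: h1 h2 e0; case: (espherical theta B) => [r| |]; last 2 first.
- by rewrite mule1 leye_eq.
- by move=> _ _; rewrite leeNy_eq.
rewrite mule1 -EFinM !lee_fin => h1 h2 r0; exists r => //.
rewrite lt_neqAle r0 andbT eq_sym; apply/eqP => r00.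
by move: h2; rewrite r00 mulr0 ler10.
Qed.

Definition free_energy (theta : R) (B : 'M[R[i]]_n.+1) : R :=
  N^-1 * ln (spherical_integral beta m theta B).

(** The logarithm turns the size of the family into an additive error, which is
    negligible for any family of subexponential size. *)
Lemma free_energy_cover theta (B B' : 'M[R[i]]_n.+1) (c : R) (Vs : seq 'M[R[i]]_n.+1) :
  0 <= theta -> corner_bounded B -> corner_bounded B' ->
  (forall V, V \in Vs -> isom_group beta n V) ->
  (forall U : 'M[R[i]]_n.+1, isom_group beta n U ->
     exists2 V, V \in Vs & corner B U <= corner B' (U *m V) + c) ->
  free_energy theta B <= free_energy theta B' + theta * c + N^-1 * ln ((size Vs)%:R).
Proof.
move=> t0 Bb Bb' VsG cov.
have [r r0 Er] := espherical_fin_pos t0 Bb.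
have [r' r'0 Er'] := espherical_fin_pos t0 Bb'.
have Vs0 : (0 < (size Vs)%:R :> R).
  have [V VVs _] := cov _ isom_group1; rewrite ltr0n.
  by case: (Vs) VVs.
have := espherical_cover t0 VsG cov; rewrite Er Er' -EFinM lee_fin => le.
have E0 : spherical_integral beta m theta B = r by rewrite -[RHS]/(fine r%:E) -Er.
have E0' : spherical_integral beta m theta B' = r' by rewrite -[RHS]/(fine r'%:E) -Er'.
rewrite /free_energy E0 E0'.
have N0 : 0 < N by rewrite ltr0n.
rewrite -(ler_pM2l N0) !mulrDr !mulrA mulfV ?gt_eqF // !mul1r.
have s0 : 0 < (size Vs)%:R * expR (N * theta * c) by rewrite mulr_gt0 ?expR_gt0.
have E : ln ((size Vs)%:R * expR (N * theta * c) * r') =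
    ln r' + N * theta * c + ln (size Vs)%:R.
  rewrite lnM ?posrE // lnM ?posrE ?expR_gt0 // expRK.
  by rewrite addrC [X in _ + X]addrC addrA.
by rewrite -E ler_ln ?posrE // mulr_gt0.
Qed.

End haar.

(** * A finite net of plane rotations *)

Section plane_rotations.
Context {R : realType}.
Implicit Types (x y z t a b : R[i]).

(** The norm of R[i] takes its values in R[i], whereas real weights are needed. *)
Definition absq z : R := complex.Re z ^+ 2 + complex.Im z ^+ 2.

Lemma absq_ge0 z : 0 <= absq z.
Proof. by rewrite addr_ge0 ?sqr_ge0. Qed.

Lemma absqM z t : absq (z * t) = absq z * absq t.
Proof. by case: z t => [a b] [c d]; rewrite /absq /=; ring. Qed.

Lemma absqN z : absq (- z) = absq z.
Proof. by rewrite /absq !raddfN /= !sqrrN. Qed.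

Lemma absq_real (r : R) : absq r%:C = r ^+ 2.
Proof. by rewrite /absq /= expr0n addr0. Qed.

Lemma mul_conjc z : z * conjc z = (absq z)%:C.
Proof.
case: z => a b; apply/eqP; rewrite eq_complex /absq /=; apply/andP; split; apply/eqP; ring.
Qed.

(** A unit vector (a, b) determines the unitary change of coordinates
    (x, y) |-> (x a^* + y b^*, a y - b x) of the plane; this is the conservation
    of the norm. *)
Lemma absq_rot a b x y : absq a + absq b = 1 ->
  absq (x * conjc a + y * conjc b) + absq (a * y - b * x) = absq x + absq y.
Proof.
move=> ab; rewrite -[RHS]mul1r -ab.
case: a b x y {ab} => [a1 a2] [b1 b2] [x1 x2] [y1 y2]; rewrite /absq /=; ring.
Qed.

Lemma adjD p q (A B : 'M[R[i]]_(p, q)) : (A + B) ^t* = A ^t* + B ^t*.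
Proof. by apply/matrixP => i j; rewrite !mxE rmorphD. Qed.

Lemma adjB p q (A B : 'M[R[i]]_(p, q)) : (A - B) ^t* = (A ^t* ) - (B ^t* ).
Proof. by apply/matrixP => i j; rewrite !mxE rmorphB. Qed.

Lemma adjM p q r (A : 'M[R[i]]_(p, q)) (B : 'M[R[i]]_(q, r)) : (A *m B) ^t* = (B ^t* ) *m (A ^t* ).
Proof. by rewrite trmx_mul map_mxM. Qed.

Lemma adj1 p : (1%:M : 'M[R[i]]_p) ^t* = 1%:M.
Proof. by rewrite trmx1 map_mx1. Qed.

(** A matrix acting as M on the plane embedded by P, with coordinates Q, and as
    the identity on a complement: products are computed blockwise. *)
Lemma conjugate_block_inverse p n (P : 'M[R[i]]_(n, p)) (Q : 'M[R[i]]_(p, n))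
    (M M' : 'M[R[i]]_p) : Q *m P = 1%:M -> M *m M' = 1%:M ->
  (1%:M + P *m (M - 1%:M) *m Q) *m (1%:M + P *m (M' - 1%:M) *m Q) = 1%:M.
Proof.
move=> QP MM'.
have H (S T : 'M[R[i]]_p) : P *m S *m Q *m (P *m T *m Q) = P *m (S *m T) *m Q.
  by rewrite !mulmxA -(mulmxA (P *m S)) QP mulmx1.
rewrite mulmxDl mul1mx mulmxDr mulmx1 H -[RHS]addr0 -addrA; congr (_ + _).
rewrite -mulmxDl -mulmxDr -mulmxDl -mulmxDr.
rewrite (_ : _ + _ = 0) ?mulmx0 ?mul0mx //.
rewrite mulmxBl mulmxBr mul1mx mulmx1 MM'.
by rewrite -(opprB M 1%:M) [X in _ + X]addrA subrr sub0r subrr.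
Qed.

Section rot.
Variables (n : nat) (j : 'I_n.+1) (a b : R[i]).
Hypothesis j0 : j != ord0.
Hypothesis ab : absq a + absq b = 1.

Let plane : 'M[R[i]]_(2, n.+1) :=
  \matrix_(k < 2, l < n.+1) (l == if k == ord0 then ord0 else j)%:R.

Let rot2 : 'M[R[i]]_2 :=
  \matrix_(k < 2, l < 2) if k == ord0 then (if l == ord0 then conjc a else - b)
                         else (if l == ord0 then conjc b else a).

Definition rotmx : 'M[R[i]]_n.+1 :=
  1%:M + plane^T *m (rot2 - 1%:M) *m plane.

Let plane_ortho : plane *m plane^T = 1%:M.
Proof.
apply/matrixP => k l; rewrite !mxE.
rewrite (bigD1 (if k == ord0 then ord0 else j)) //= big1 => [|i ik]; last first.
  by rewrite !mxE (negPf ik) mul0r.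
rewrite !mxE eqxx mul1r addr0.
have j0v : (nat_of_ord j == 0%N) = false := negPf j0.
by case: k l => -[|[|//]] ? [] [|[|//]] ?; rewrite -!val_eqE /= ?eqxx // ?j0v // eq_sym j0v.
Qed.

Let rot2_unitary : rot2 *m rot2 ^t* = 1%:M.
Proof.
have nab : a * conjc a + b * conjc b = 1.
  by rewrite !mul_conjc -rmorphD ab.
apply/matrixP => k l; rewrite !mxE !big_ord_recl big_ord0 !mxE /= addr0 !conj_conjc.
case: k l => -[|[|//]] ? [] [|[|//]] ?; rewrite -?val_eqE /= ?conjcK ?raddfN /= ?conjcK.
- by rewrite mulrNN mulrC.
- by rewrite mulrC mulNr subrr.
- by rewrite mulrN mulrC subrr.
- by rewrite mulrC addrC.
Qed.

Let plane_real : plane ^t* = plane^T.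
Proof. by apply/matrixP => k l; rewrite !mxE conjC_nat. Qed.

Lemma rotmx_unitary : rotmx \is unitarymx.
Proof.
have E : rotmx ^t* = 1%:M + plane^T *m (rot2 ^t* - 1%:M) *m plane.
  rewrite /rotmx adjD !adjM adjB !adj1 plane_real mulmxA; congr (_ + _ *m _ *m _).
  by rewrite -plane_real trmxCK.
apply/unitarymxP; rewrite E /rotmx.
exact: (conjugate_block_inverse plane_ortho rot2_unitary).
Qed.

Lemma rotmx_row (U : 'M[R[i]]_n.+1) i l : (U *m rotmx) i l =
  if l == ord0 then U i ord0 * conjc a + U i j * conjc b
  else if l == j then a * U i j - b * U i ord0 else U i l.
Proof.
rewrite /rotmx mulmxDr mulmx1 !mulmxA mxE.
have E k : (U *m plane^T) i k = U i (if k == ord0 then ord0 else j).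
  rewrite mxE (bigD1 (if k == ord0 then ord0 else j)) //= big1 => [|p pk].
    by rewrite !mxE eqxx mulr1 addr0.
  by rewrite !mxE (negPf pk) mulr0.
rewrite mxE !big_ord_recl big_ord0 !mxE !big_ord_recl !big_ord0 !E !mxE /= !addr0.
have [->|l0] := eqVneq l ord0.
  rewrite eq_sym (negPf j0) /=; ring.
have [->|lj] := eqVneq l j; first by rewrite /=; ring.
by rewrite /=; ring.
Qed.

End rot.

(** The grid -1, -1 + 1/L, ..., 1, indexed so that it can be enumerated. *)
Lemma grid_approx (L : nat) (r : R) : (0 < L)%N -> `|r| <= 1 ->
  exists2 k : 'I_(L.*2.+1), true & `|r - ((k%:R - L%:R) / L%:R)| <= L%:R^-1.
Proof.
move=> L0 r1; have L0' : 0 < L%:R :> R by rewrite ltr0n.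
have /andP[rl ru] : -1 <= r <= 1 by rewrite -ler_norml.
have t0 : 0 <= L%:R * (r + 1).
  by apply: mulr_ge0; [exact: ltW | rewrite -lerBlDr sub0r].
have /andP[h1 h2] := truncn_itv t0.
set k := Num.truncn _ in h1 h2.
have kL : (k < L.*2.+1)%N.
  rewrite ltnS -(ler_nat R) (le_trans h1) // -addnn natrD.
  by rewrite mulrDr mulr1 lerD2r -[leRHS]mulr1 ler_wpM2l // ltW.
exists (Ordinal kL) => //=.
rewrite -(ler_pM2l L0') -[X in X * `|_|](gtr0_norm L0') -normrM mulrBr.
rewrite mulrCA mulfV ?gt_eqF // mulr1 ler_norml.
rewrite -natr1 in h2; apply/andP; split; nra.
Qed.

(** For beta = 1 the grid consists of real numbers, so that the rotations built
    from it stay in the orthogonal group. *)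
Definition slope_grid (beta L : nat) : seq R[i] :=
  [seq Complex ((p%:R - L%:R) / L%:R) (if beta == 1%N then 0 else (q%:R - L%:R) / L%:R)
     | p : 'I_(L.*2.+1) <- enum 'I_(L.*2.+1), q : 'I_(L.*2.+1) <- enum 'I_(L.*2.+1)].

Lemma size_slope_grid beta L : size (slope_grid beta L) = (L.*2.+1 ^ 2)%N.
Proof. by rewrite size_allpairs size_enum_ord. Qed.

Lemma slope_grid_real L t : t \in slope_grid 1 L -> complex.Im t = 0.
Proof. by move=> /allpairsP[[p q] /= [_ _ ->]]. Qed.

Lemma slope_grid_approx beta L t : (0 < L)%N -> absq t <= 1 ->
  (beta = 1%N -> complex.Im t = 0) ->
  exists2 s, s \in slope_grid beta L & absq (t - s) <= 2 / L%:R ^+ 2.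
Proof.
move=> L0 t1 tr; have L0' : 0 < L%:R :> R by rewrite ltr0n.
have small (u : R) : u ^+ 2 <= 1 -> `|u| <= 1.
  by move=> u1; rewrite -(@ler_pXn2r _ 2) ?nnegrE // real_normK ?num_real // expr1n.
have [p _ hp] : exists2 k : 'I_(L.*2.+1), true &
    `|complex.Re t - ((k%:R - L%:R) / L%:R)| <= L%:R^-1.
  by apply: grid_approx => //; apply: small; apply: le_trans t1; rewrite lerDl sqr_ge0.
have [q _ hq] : exists2 k : 'I_(L.*2.+1), true &
    `|complex.Im t - ((k%:R - L%:R) / L%:R)| <= L%:R^-1.
  by apply: grid_approx => //; apply: small; apply: le_trans t1; rewrite lerDr sqr_ge0.
have sq (u : R) : `|u| <= L%:R^-1 -> u ^+ 2 <= L%:R ^- 2.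
  move=> h; rewrite -(real_normK (num_real u)) -exprVn.
  by apply: lerXn2r; rewrite ?nnegrE // invr_ge0 ltW.
exists (Complex ((p%:R - L%:R) / L%:R) (if beta == 1%N then 0 else (q%:R - L%:R) / L%:R)).
  by apply/allpairsP; exists (p, q); rewrite !mem_enum.
rewrite /absq mulr_natl mulr2n lerD //.
  by rewrite raddfB /=; apply: sq.
rewrite raddfB /=; case: eqP => [b1|_]; last exact: sq.
by rewrite tr // subr0 expr0n /= invr_ge0 sqr_ge0.
Qed.

Local Notation inv_norm t := (((Num.sqrt (1 + absq t))^-1)%:C).

(** The unit vectors (1, t) / r and (t, 1) / r with t on the grid of slopes: a
    line of the plane has slope of modulus at most 1 with respect to one of the
    two axes. *)
Definition directions (beta L : nat) : seq (R[i] * R[i]) :=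
  [seq (inv_norm t, inv_norm t * t) | t <- slope_grid beta L] ++
  [seq (inv_norm t * t, inv_norm t) | t <- slope_grid beta L].

Lemma size_directions beta L : size (directions beta L) = (2 * L.*2.+1 ^ 2)%N.
Proof. by rewrite size_cat !size_map !size_slope_grid mul2n addnn. Qed.

Let inv_norm_sq t : (Num.sqrt (1 + absq t))^-1 ^+ 2 = (1 + absq t)^-1.
Proof. by rewrite exprVn sqr_sqrtr // addr_ge0 // absq_ge0. Qed.

Lemma directions_unit beta L ab : ab \in directions beta L -> absq ab.1 + absq ab.2 = 1.
Proof.
have H t : absq (inv_norm t) + absq (inv_norm t * t) = 1.
  rewrite absqM absq_real inv_norm_sq -{1}[_^-1]mulr1 -mulrDr mulVf //.
  by rewrite gt_eqF // ltr_pwDl // absq_ge0.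
by rewrite mem_cat => /orP[] /mapP[t _ ->] /=; rewrite // addrC.
Qed.

Lemma directions_real L ab : ab \in directions 1 L -> complex.Im ab.1 = 0 /\ complex.Im ab.2 = 0.
Proof.
rewrite mem_cat => /orP[] /mapP[t /slope_grid_real tr ->] /=; rewrite Im_mulc /= tr; split; ring.
Qed.

(** The second coordinate after rotation is a y - b x, up to the normalisation
    x times the error made on the slope y / x. *)
Lemma directions_approx beta L x y : (0 < L)%N ->
  (beta = 1%N -> complex.Im x = 0 /\ complex.Im y = 0) ->
  exists2 ab, ab \in directions beta L &
    absq (ab.1 * y - ab.2 * x) <= 2 / L%:R ^+ 2 * (absq x + absq y).
Proof.
move=> L0.
have key x' y' : absq y' <= absq x' ->
    (beta = 1%N -> complex.Im x' = 0 /\ complex.Im y' = 0) ->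
  exists2 t, t \in slope_grid beta L &
    absq (inv_norm t * (y' - t * x')) <= 2 / L%:R ^+ 2 * (absq x' + absq y').
  move=> yx xyr.
  (* if x' = 0 then y' = 0, and any slope of the grid will do *)
  have [x0|x0] := eqVneq x' 0.
    have [t tS _] : exists2 s, s \in slope_grid beta L & absq (0 - s) <= 2 / L%:R ^+ 2.
      by apply: slope_grid_approx => //; rewrite absq_real expr0n.
    exists t => //.
    move: yx; rewrite x0 mulr0 subr0 absqM (absq_real 0) expr0n /= add0r => y0.
    have -> : absq y' = 0 by apply/eqP; rewrite eq_le y0 absq_ge0.
    by rewrite !mulr0.
  have ax0 : 0 < absq x'.
    rewrite lt_neqAle absq_ge0 andbT eq_sym /absq paddr_eq0 ?sqr_ge0 // !sqrf_eq0.
    by move: x0; rewrite eq_complex.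
  have [t tS ht] : exists2 s, s \in slope_grid beta L & absq (y' / x' - s) <= 2 / L%:R ^+ 2.
    apply: slope_grid_approx => //.
      by rewrite -(ler_pM2r ax0) -absqM mul1r divfK.
    move=> /xyr[]; case: (x') (y') => [a1 a2] [b1 b2] /= -> ->; ring.
  exists t => //.
  have -> : y' - t * x' = (y' / x' - t) * x' by rewrite mulrBl divfK.
  rewrite !absqM absq_real inv_norm_sq mulrCA mulrA.
  have d0 : 0 <= 2 / L%:R ^+ 2 :> R by rewrite mulr_ge0 // invr_ge0 sqr_ge0.
  apply: (@le_trans _ _ (2 / L%:R ^+ 2 * absq x')); last first.
    by rewrite ler_wpM2l // lerDl absq_ge0.
  rewrite ler_wpM2r ?absq_ge0 // -[leRHS]mulr1 ler_pM ?absq_ge0 //.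
    by rewrite invr_ge0 addr_ge0 ?absq_ge0.
  by rewrite invf_le1 ?lerDl ?absq_ge0 // ltr_pwDl ?absq_ge0.
move=> xyr; have [yx|/ltW yx] := leP (absq y) (absq x).
  have [t tS ht] := key x y yx xyr.
  exists (inv_norm t, inv_norm t * t).
    by rewrite mem_cat map_f.
  by move: ht; rewrite mulrBr mulrA.
have [t tS ht] := key y x yx (fun e => let: conj h1 h2 := xyr e in conj h2 h1).
exists (inv_norm t * t, inv_norm t).
  by rewrite mem_cat (map_f (fun t => (inv_norm t * t, inv_norm t))) ?orbT.
rewrite /= [absq x + _]addrC (_ : _ - _ = - (inv_norm t * (x - t * y))).
  by rewrite absqN.
by ring.
Qed.

End plane_rotations.

(** * Diagonal matrices: replacing eigenvalues one at a time *)

Section diagonal.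
Context {R : realType} (beta n : nat) (m : probability (borel_mx R n) R).
Hypothesis hm : is_haar beta m.
Variable theta : R.
Hypothesis theta0 : 0 <= theta.
Implicit Types d : 'I_n.+1 -> R.

(** Spectra are kept as functions to the reals, in any order. *)
Definition rdiag d : 'M[R[i]]_n.+1 := diag_mx (\row_i (d i)%:C).

Lemma corner_rdiag d (U : 'M[R[i]]_n.+1) :
  corner (rdiag d) U = \sum_i d i * absq (U ord0 i).
Proof.
rewrite /corner mul_mx_diag mxE raddf_sum; apply: eq_bigr => i _.
rewrite !mxE conj_conjc /=; case: (U ord0 i) => a b; rewrite /absq /=; ring.
Qed.

Lemma sum_absq_row (U : 'M[R[i]]_n.+1) : isom_group beta n U ->
  \sum_i absq (U ord0 i) = 1.
Proof.
move=> /isom_groupK /matrixP /(_ ord0 ord0); rewrite !mxE eqxx => E.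
apply: complexI; rewrite rmorph_sum -[RHS]E; apply: eq_bigr => i _.
by rewrite !mxE conj_conjc mul_conjc.
Qed.

Lemma corner_rdiag_le d c (U : 'M[R[i]]_n.+1) : isom_group beta n U ->
  (forall i, d i <= c) -> corner (rdiag d) U <= c.
Proof.
move=> UG dc; rewrite corner_rdiag -[leRHS]mulr1 -(sum_absq_row UG) mulr_sumr.
by apply: ler_sum => i _; rewrite ler_wpM2r ?absq_ge0.
Qed.

Lemma corner_bounded_rdiag d : corner_bounded beta (rdiag d).
Proof.
have dle i : `|d i| <= \sum_j `|d j| by rewrite (bigD1 i) //= lerDl sumr_ge0.
exists (\sum_i `|d i|) => U UG; rewrite ler_norml; apply/andP; split.
  rewrite lerNl.
  have -> : - corner (rdiag d) U = corner (rdiag (fun i => - d i)) U.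
    by rewrite !corner_rdiag -sumrN; apply: eq_bigr => i _; rewrite mulNr.
  by apply: corner_rdiag_le => // i; rewrite (le_trans _ (dle i)) // -normrN ler_norm.
by apply: corner_rdiag_le => // i; rewrite (le_trans _ (dle i)) // ler_norm.
Qed.

Definition diag_energy d := free_energy beta m theta (rdiag d).

Lemma diag_energy_mono d d' c : (forall i, d i <= d' i + c) ->
  diag_energy d <= diag_energy d' + theta * c.
Proof.
move=> dd'.
have := @free_energy_cover _ _ _ _ hm theta (rdiag d) (rdiag d') c [:: 1%:M] theta0
  (corner_bounded_rdiag d) (corner_bounded_rdiag d').
rewrite /= ln1 mulr0 addr0; apply.
  by move=> V; rewrite inE => /eqP ->; exact: isom_group1.
move=> U UG; exists 1%:M; first by rewrite inE.
rewrite mulmx1 -[c]mulr1 -(sum_absq_row UG) mulr_sumr !corner_rdiag -big_split /=.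
by apply: ler_sum => i _; rewrite -mulrDl ler_wpM2r ?absq_ge0.
Qed.

Lemma isom_group_perm_mx (s : {perm 'I_n.+1}) :
  isom_group beta n (perm_mx s : 'M[R[i]]_n.+1).
Proof.
apply/andP; split.
  apply/unitarymxP; rewrite tr_perm_mx map_perm_mx -perm_mxM.
  by rewrite mulgV perm_mx1.
by apply/implyP => _; apply/mxOverP => i j; rewrite !mxE; case: eqP => _; rewrite ?rpred0 ?rpred1.
Qed.

(** Permutation matrices are real and unitary. *)
Lemma diag_energy_perm d d' (s : {perm 'I_n.+1}) :
  (forall i, d i = d' (s i)) -> diag_energy d <= diag_energy d'.
Proof.
move=> dd'.
have := @free_energy_cover _ _ _ _ hm theta (rdiag d) (rdiag d') 0 [:: perm_mx s] theta0
  (corner_bounded_rdiag d) (corner_bounded_rdiag d').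
rewrite /= ln1 !mulr0 !addr0; apply.
  by move=> V; rewrite inE => /eqP ->; exact: isom_group_perm_mx.
move=> U UG; exists (perm_mx s); first by rewrite inE.
rewrite addr0 !corner_rdiag [leRHS](reindex_inj (@perm_inj _ s)) /=.
rewrite le_eqVlt; apply/orP; left; apply/eqP; apply: eq_bigr => i _.
have -> : (U *m perm_mx s) ord0 (s i) = U ord0 i.
  by have := col_permE (s^-1)%g U; rewrite invgK => <-; rewrite mxE permK.
by rewrite dd'.
Qed.

(** The first term is the loss due to the mesh 1/L of the net of rotations, the
    second one the logarithm of its size. *)
Definition step_cost (L : nat) (W : R) : R :=
  theta * (W * (2 / L%:R ^+ 2)) + (n.+1%:R)^-1 * ln (2 * L.*2.+1 ^ 2)%:R.

Lemma isom_group_rotmx (j : 'I_n.+1) (L : nat) (ab : R[i] * R[i]) : j != ord0 ->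
  ab \in directions beta L -> isom_group beta n (rotmx j ab.1 ab.2).
Proof.
move=> j0 abd; apply/andP; split.
  by apply: rotmx_unitary => //; exact: directions_unit abd.
apply/implyP => /eqP b1; rewrite b1 in abd; have [ra rb] := directions_real abd.
have cr (z : R[i]) : complex.Im z = 0 -> conjc z \is Num.real.
  by case: z => a b /= ->; rewrite complex_real oppr0.
have r (z : R[i]) : complex.Im z = 0 -> z \is Num.real.
  by case: z => a b /= ->; rewrite complex_real.
apply/mxOverP => k l; rewrite -[rotmx _ _ _]mul1mx rotmx_row //.
have r1 p q : (1%:M : 'M[R[i]]_n.+1) p q \is Num.real.
  by rewrite mxE; case: eqP => _; rewrite ?rpred0 ?rpred1.
case: ifP => _; first by rewrite rpredD // rpredM // cr.
by case: ifP => _ //; rewrite rpredB // rpredM // r.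
Qed.

(** Bounding d_j by d_0 makes the form constant on the plane (0, j); a rotation
    from the net then leaves at most 2/L^2 of the mass on the coordinate j, where
    passing from d_0 to d'_j loses at most W times this mass. *)
Lemma diag_energy_step d d' (j : 'I_n.+1) (L : nat) (W : R) :
  (0 < L)%N -> 0 <= W -> j != ord0 -> (forall i, i != j -> d i = d' i) ->
  d j <= d ord0 -> d ord0 - d' j <= W ->
  diag_energy d <= diag_energy d' + step_cost L W.
Proof.
move=> L0 W0 j0 dd' dj0 d0W.
rewrite /step_cost addrA -(size_directions (R := R) beta L).
rewrite -(size_map (fun ab => rotmx j ab.1 ab.2)).
apply: free_energy_cover => //; try exact: corner_bounded_rdiag.
  by move=> V /mapP[ab abd ->]; exact: isom_group_rotmx abd.
move=> U UG.
have Ur : beta = 1%N -> complex.Im (U ord0 ord0) = 0 /\ complex.Im (U ord0 j) = 0.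
  move=> b1; move: UG => /andP[_]; rewrite b1 /= => /mxOverP Ur.
  have im (z : R[i]) : z \is Num.real -> complex.Im z = 0.
    by case: z => a b; rewrite complex_real => /eqP.
  by split; apply: im.
have [ab abd hab] := directions_approx L0 Ur.
exists (rotmx j ab.1 ab.2); first by apply/mapP; exists ab.
have split_sum (F : 'I_n.+1 -> R) : \sum_i F i =
    F ord0 + F j + \sum_(i | (i != ord0) && (i != j)) F i.
  by rewrite (bigD1 ord0) //= (bigD1 j) //= addrA.
rewrite !corner_rdiag !split_sum !rotmx_row // eqxx (negPf j0) eqxx.
set z1 := absq (_ + _); set z2 := absq (_ - _) in hab *.
have z : z1 + z2 = absq (U ord0 ord0) + absq (U ord0 j).
  by apply: absq_rot; exact: directions_unit abd.
rewrite [X in _ <= _ + X + _](_ : _ =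
  \sum_(i | (i != ord0) && (i != j)) d i * absq (U ord0 i)); last first.
  apply: eq_bigr => i /andP[i0 ij].
  by rewrite rotmx_row // (negPf i0) (negPf ij) dd'.
rewrite [leRHS]addrAC lerD2r -dd' 1?eq_sym //.
have xy1 : absq (U ord0 ord0) + absq (U ord0 j) <= 1.
  rewrite -(sum_absq_row UG) split_sum lerDl sumr_ge0 // => i _; exact: absq_ge0.
have e0 : 0 <= 2 / L%:R ^+ 2 :> R by rewrite mulr_ge0 // invr_ge0 sqr_ge0.
have z2e : z2 <= 2 / L%:R ^+ 2.
  by rewrite (le_trans hab) // -[leRHS]mulr1 ler_wpM2l.
have z20 : 0 <= z2 := absq_ge0 _.
have y0 : 0 <= absq (U ord0 j) := absq_ge0 _.
have h1 : d j * absq (U ord0 j) <= d ord0 * absq (U ord0 j) by rewrite ler_wpM2r.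
have h2 : (d ord0 - d' j) * z2 <= W * (2 / L%:R ^+ 2).
  apply: (@le_trans _ _ (W * z2)); first by rewrite ler_wpM2r.
  by rewrite ler_wpM2l.
have h3 : d ord0 * absq (U ord0 ord0) + d ord0 * absq (U ord0 j) = d ord0 * z1 + d ord0 * z2.
  by rewrite -!mulrDr z.
rewrite mulrBl in h2.
by apply: le_trans (lerD (lexx _) h1) _; rewrite h3 -addrA lerD2l -lerBlDl.
Qed.

Definition override d d' (s : seq 'I_n.+1) : 'I_n.+1 -> R :=
  fun i => if i \in s then d' i else d i.

Lemma diag_energy_steps d d' (s : seq 'I_n.+1) (L : nat) (W : R) :
  (0 < L)%N -> 0 <= W -> uniq s -> ord0 \notin s ->
  {in s, forall j, d j <= d ord0} -> {in s, forall j, d ord0 - d' j <= W} ->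
  diag_energy d <= diag_energy (override d d' s) + (size s)%:R * step_cost L W.
Proof.
move=> L0 W0; elim: s => [|j s IH] /=.
  move=> _ _ _ _; rewrite mul0r addr0 -[leRHS]addr0 -(mulr0 theta).
  by apply: diag_energy_mono => i; rewrite addr0.
move=> /andP[js us]; rewrite inE negb_or => /andP[j0 s0] h1 h2.
have {}IH := IH us s0 (fun k ks => h1 k (mem_behead (s := j :: s) ks))
  (fun k ks => h2 k (mem_behead (s := j :: s) ks)).
have jj : j \in j :: s by rewrite mem_head.
have st : diag_energy (override d d' s) <= diag_energy (override d d' (j :: s)) + step_cost L W.
  apply: (@diag_energy_step _ _ j) => //.
  - by rewrite eq_sym.
  - by move=> i ij; rewrite /override inE (negPf ij).
  - by rewrite /override (negPf js) (negPf s0); exact: h1.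
  - by rewrite /override (negPf s0) mem_head; exact: h2.
have -> : (size s).+1%:R * step_cost L W = step_cost L W + (size s)%:R * step_cost L W.
  by rewrite -[(size s).+1]add1n natrD mulrDl mul1r.
rewrite addrA; exact: (le_trans IH (lerD st (lexx _))).
Qed.

End diagonal.

(** * Orthogonal diagonalization of real symmetric matrices *)

Section real_spectral.
Context {R : realType}.

(** For a left eigenvector v, v A v^t* is real and equals a times |v|^2. *)
Lemma hermitian_eigenvalue_real n (A : 'M[R[i]]_n) (a : R[i]) :
  A ^t* = A -> eigenvalue A a -> complex.Im a = 0.
Proof.
move=> AA /eigenvalueP[v vA v0].
have E : (v *m A *m v ^t* ) 0 0 = a * dotmx v v.
  by rewrite vA -scalemxAl mxE dotmxE.
have Ec : Num.conj ((v *m A *m v ^t* ) 0 0) = (v *m A *m v ^t* ) 0 0.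
  transitivity (((v *m A *m v ^t* ) ^t* ) 0 0); first by rewrite !mxE.
  by rewrite !adjM trmxCK AA mulmxA.
have s0 : 0 < dotmx v v by rewrite dnorm_gt0.
have sr : Num.conj (dotmx v v) = dotmx v v by apply/CrealP; exact: gtr0_real.
have : Num.conj a * dotmx v v = a * dotmx v v.
  by rewrite -[X in _ * X = _]sr -[LHS]rmorphM -E; exact: Ec.
move=> /(mulIf (lt0r_neq0 s0)).
rewrite conj_conjc; case: a {E vA} => x y /= [] /eqP.
by rewrite eq_sym -addr_eq0 -mulr2n mulrn_eq0 => /eqP.
Qed.

Lemma symmetric_eigenvector n (A : 'M[R]_n.+1) : A^T = A ->
  exists r : R, exists2 v : 'rV[R]_n.+1, v != 0 & v *m A = r *: v.
Proof.
move=> AT; pose AC := map_mx (real_complex R) A.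
have [a ea] := @eigenvalue_closed R[i] _ AC isT.
have ACh : AC ^t* = AC.
  apply/matrixP => i j; rewrite !mxE conj_conjc conjc_real.
  by move/matrixP: AT => /(_ j i); rewrite mxE => ->.
have ar := hermitian_eigenvalue_real ACh ea.
exists (complex.Re a).
have : eigenvalue A (complex.Re a).
  rewrite eigenvalue_root_char -(fmorph_root (real_complex R)) map_char_poly.
  rewrite -eigenvalue_root_char; rewrite [X in eigenvalue _ X](_ : _ = a) //.
  by case: (a) ar => x y /= ->.
by move=> /eigenvalueP[v vA v0]; exists v.
Qed.

(** The Householder reflection in the hyperplane orthogonal to e_0 - u, or the
    identity if u = e_0. *)
Lemma reflection_to_axis n (u : 'rV[R]_n.+1) : u *m u^T = 1%:M ->
  exists H : 'M[R]_n.+1, [/\ H^T = H, H *m H = 1%:M & u *m H = delta_mx 0 0].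
Proof.
move=> uu; pose e : 'rV[R]_n.+1 := delta_mx 0 0.
have [ue|ue] := eqVneq u e.
  by exists 1%:M; rewrite trmx1 !mulmx1 ue.
pose w := e - u; pose s := (w *m w^T) 0 0.
have ee : e *m e^T = 1%:M.
  by rewrite /e trmx_delta mul_delta_mx; apply/matrixP => i j; rewrite !ord1 !mxE.
have ww : w *m w^T = s%:M by rewrite [LHS]mx11_scalar.
have s0 : s != 0.
  apply: contra ue => /eqP s0; rewrite eq_sym -subr_eq0; apply/eqP/rowP => k.
  have sE : s = \sum_k (w 0 k) ^+ 2.
    by rewrite /s mxE; apply: eq_bigr => i _; rewrite [w^T _ _]mxE expr2.
  have : \sum_k (w 0 k) ^+ 2 == 0 by rewrite -sE s0.
  rewrite psumr_eq0 => [/allP|i _]; last exact: sqr_ge0.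
  by move=> /(_ k (mem_index_enum _)); rewrite /= sqrf_eq0 => /eqP wk; rewrite [RHS]mxE.
have uw : u *m w^T = (- (s / 2))%:M.
  have eu : e *m u^T = u *m e^T.
    by rewrite [LHS]mx11_scalar [RHS]mx11_scalar -[in LHS](trmxK e) -trmx_mul mxE.
  have E : s%:M = 2 *: (1%:M - u *m e^T) :> 'M[R]_1.
    rewrite -ww /w raddfB /= mulmxBl !mulmxBr ee uu eu.
    by rewrite -(opprB 1%:M) opprK scaler_nat mulr2n.
  have -> : (- (s / 2))%:M = - (2^-1 *: s%:M) :> 'M[R]_1.
    by rewrite scale_scalar_mx mulrC raddfN.
  by rewrite E scalerA mulVf ?pnatr_eq0 // scale1r opprB /w raddfB /= mulmxBr uu.
have KK : w^T *m w *m (w^T *m w) = s *: (w^T *m w).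
  by rewrite mulmxA -(mulmxA w^T) ww mul_mx_scalar -scalemxAl.
have uK : u *m (w^T *m w) = - (s / 2) *: w by rewrite mulmxA uw mul_scalar_mx.
have KT : (w^T *m w)^T = w^T *m w by rewrite trmx_mul trmxK.
move: (w^T *m w) KK uK KT => K KK uK KT.
exists (1%:M - (2 / s) *: K); split.
- by rewrite raddfB /= trmx1 linearZ /= KT.
- rewrite mulmxBl mul1mx mulmxBr mulmx1 -scalemxAl -scalemxAr KK !scalerA.
  rewrite (_ : 2 / s * (2 / s) * s = 2 / s + 2 / s); last by field.
  by rewrite scalerDl opprB addrK subrK.
- rewrite mulmxBr mulmx1 -scalemxAr uK scalerA.
  rewrite (_ : _ * _ = -1); last by field.
  by rewrite scaleN1r opprK /w addrC subrK.
Qed.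

(** The unitary diagonalization of a real matrix need not be real, whereas the
    orthogonal group requires a real one.  A real unit eigenvector is moved to
    e_0 by a reflection, which splits off a block of size 1; the symmetry of the
    matrix makes the remaining block symmetric. *)
Lemma symmetric_diagonalization n (A : 'M[R]_n) : A^T = A ->
  exists P : 'M[R]_n, exists2 d : 'rV[R]_n,
    P *m P^T = 1%:M & A = P^T *m diag_mx d *m P.
Proof.
elim: n A => [|n IH] A AT.
  by exists 1%:M, 0; apply/matrixP; case.
have [r [v v0 vA]] := symmetric_eigenvector AT.
pose s := (v *m v^T) 0 0.
have s0 : 0 < s.
  have se : s = \sum_k (v 0 k) ^+ 2.
    by rewrite /s mxE; apply: eq_bigr => i _; rewrite [v^T _ _]mxE expr2.
  rewrite lt_neqAle eq_sym se sumr_ge0 ?andbT => [|i _]; last exact: sqr_ge0.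
  apply: contra v0; rewrite psumr_eq0 => [/allP h|i _]; last exact: sqr_ge0.
  apply/eqP/rowP => k; rewrite mxE.
  by have := h k (mem_index_enum _); rewrite /= sqrf_eq0 => /eqP.
pose u := (Num.sqrt s)^-1 *: v.
have uu : u *m u^T = 1%:M.
  rewrite /u linearZ /= -scalemxAl -scalemxAr scalerA [v *m _]mx11_scalar -/s.
  rewrite scale_scalar_mx -invfM -expr2 sqr_sqrtr ?ltW // mulVf //.
  by rewrite gt_eqF.
have uA : u *m A = r *: u by rewrite -scalemxAl vA !scalerA mulrC.
have [H [HT HH uH]] := reflection_to_axis uu.
pose A' := H *m A *m H.
have A'T : A'^T = A' by rewrite /A' !trmx_mul HT AT mulmxA.
have eA' : delta_mx 0 0 *m A' = r *: (delta_mx 0 0 : 'rV[R]_n.+1).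
  by rewrite -uH /A' !mulmxA -(mulmxA u) HH mulmx1 uA -scalemxAl.
have A'row j : A' 0 j = r *+ (j == 0).
  by move/rowP: eA' => /(_ j); rewrite -rowE !mxE eqxx /= mulr_natr.
have AE : A = H *m A' *m H.
  by rewrite /A' !mulmxA HH mul1mx -mulmxA HH mulmx1.
clearbody A'.
(* the same matrix, with a type that exhibits the block decomposition *)
pose A1 : 'M[R]_(1 + n) := A'.
have A1row (a b : 'I_(1 + n)) : nat_of_ord a = 0%N -> A1 a b = r *+ (nat_of_ord b == 0%N).
  by move=> a0; have -> : a = 0 by [apply/val_inj]; exact: A'row.
have A1T a b : A1 a b = A1 b a by rewrite -[A1 in LHS]A'T mxE.
have A1E : A1 = block_mx r%:M 0 0 (drsubmx A1).
  rewrite -[LHS]submxK; congr (block_mx _ _ _ _).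
  - by apply/matrixP => i j; rewrite !ord1 !mxE A1row.
  - by apply/matrixP => i j; rewrite !ord1 !mxE A1row.
  - by apply/matrixP => i j; rewrite !ord1 !mxE A1T A1row.
have [|P' [d' PP' A1d]] := IH (drsubmx A1).
  by rewrite trmx_drsub (_ : A1^T = A1).
pose P := block_mx 1%:M 0 0 P' : 'M[R]_(1 + n).
have PT : P^T = block_mx 1%:M 0 0 P'^T.
  by rewrite /P tr_block_mx trmx1 !trmx0.
have PP : P *m P^T = 1%:M.
  rewrite PT /P mulmx_block !mulmx0 !mul0mx !mulmx1 !addr0 !add0r PP'.
  by rewrite -scalar_mx_block.
exists (P *m H), (row_mx r%:M d').
  by rewrite trmx_mul HT mulmxA -(mulmxA P) HH mulmx1.
have E : A1 = P^T *m diag_mx (row_mx r%:M d' : 'rV_(1 + n)) *m P.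
  rewrite {1}A1E PT /P diag_mx_row !mulmx_block !(mulmx0, mul0mx, mulmx1, mul1mx, addr0, add0r).
  by rewrite -A1d; congr (block_mx _ _ _ _); apply/matrixP => i j; rewrite !ord1 !mxE.
by rewrite AE -[A']/A1 E trmx_mul HT !mulmxA.
Qed.

End real_spectral.

(** * Reduction to the sorted eigenvalues *)

Section eigenvalues.
Context {R : realType}.

Lemma realmx_Re m n (B : 'M[R[i]]_(m, n)) : B \is a realmx ->
  B = map_mx (real_complex R) (map_mx (@complex.Re R) B).
Proof.
move=> /mxOverP Br; apply/matrixP => i j; rewrite !mxE.
by have := Br i j; case: (B i j) => a b; rewrite complex_real => /eqP ->.
Qed.

Lemma self_adjointK beta n (B : 'M[R[i]]_n.+1) : self_adjoint beta B -> B ^t* = B.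
Proof.
by move=> /andP[/is_hermitianmxP E _]; move: E; rewrite expr0 scale1r => <-.
Qed.

Lemma self_adjoint_diagonalization beta n (B : 'M[R[i]]_n.+1) :
  self_adjoint beta B ->
  exists P : 'M[R[i]]_n.+1, exists2 d : 'I_n.+1 -> R,
    isom_group beta n P & B = P ^t* *m rdiag d *m P.
Proof.
move=> Bs; have Bh := self_adjointK Bs; move: Bs => /andP[Bherm].
rewrite /isom_group /=; case: (beta == 1%N) => /= [Breal|_].
  pose A := map_mx (@complex.Re R) B.
  have BA : B = map_mx (real_complex R) A := realmx_Re Breal.
  have AT : A^T = A.
    apply/matrixP => i j; rewrite !mxE.
    by move/matrixP: Bh => /(_ i j); rewrite !mxE conj_conjc => <-; rewrite Re_conjc.
  have [P [d PP Ad]] := symmetric_diagonalization AT.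
  have Padj : (map_mx (real_complex R) P) ^t* = map_mx (real_complex R) P^T.
    by apply/matrixP => i j; rewrite !mxE conj_conjc conjc_real.
  exists (map_mx (real_complex R) P), (fun i => d 0 i).
    rewrite [in X in X && _]qualifE Padj -map_mxM PP map_mx1 eqxx /=.
    by apply/mxOverP => i j; rewrite !mxE complex_real.
  rewrite Padj {1}BA {1}Ad !map_mxM map_diag_mx /rdiag.
  by have -> : map_mx (real_complex R) d = \row_i (d 0 i)%:C by apply/rowP => i; rewrite !mxE.
have Bn := hermitian_normalmx Bherm.
have dr := hermitian_spectral_diag_real Bherm.
exists (spectralmx B), (fun i => complex.Re (spectral_diag B 0 i)).
  by rewrite spectral_unitarymx.
have dE : spectral_diag B = \row_i (complex.Re (spectral_diag B 0 i))%:C.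
  by apply/rowP => i; rewrite mxE RRe_real //; move/mxOverP: dr.
rewrite /rdiag -dE -invmx_unitary; last exact: spectral_unitarymx.
exact: orthomx_spectralP Bn.
Qed.

Lemma char_poly_conjugate (F : fieldType) n (P Q A : 'M[F]_n) : Q *m P = 1%:M ->
  char_poly (P *m A *m Q) = char_poly A.
Proof.
move=> QP; have PQ := mulmx1C QP.
have PQX : map_mx polyC P *m map_mx polyC Q = 1%:M.
  by rewrite -map_mxM PQ map_mx1.
have E : char_poly_mx (P *m A *m Q) =
    map_mx polyC P *m char_poly_mx A *m map_mx polyC Q.
  rewrite /char_poly_mx !map_mxM mulmxBr mulmxBl mul_mx_scalar -scalemxAl.
  by rewrite PQX scalemx1.
by rewrite /char_poly E !det_mulmx mulrAC -det_mulmx PQX det1 mul1r.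
Qed.

(** Both lists are the roots of the characteristic polynomial. *)
Lemma eigval_diagonal n (B P : 'M[R[i]]_n.+1) (d : 'I_n.+1 -> R) :
  P *m P ^t* = 1%:M -> B = P ^t* *m rdiag d *m P ->
  exists s : {perm 'I_n.+1}, forall i : 'I_n.+1, eigval B i = d (s i).
Proof.
move=> PP BE.
have cB : char_poly B = \prod_(z <- [seq (d i)%:C | i <- enum 'I_n.+1]) ('X - z%:P).
  rewrite BE char_poly_conjugate // char_poly_trig ?diag_mx_is_trig //.
  rewrite big_map big_enum /=; apply: eq_bigr => i _.
  by rewrite /rdiag !mxE eqxx mulr1n.
have perm_roots : perm_eq (sval (closed_field_poly_normal (char_poly B)))
    [seq (d i)%:C | i <- enum 'I_n.+1].
  case: (closed_field_poly_normal _) => r /= Er.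
  apply: prod_XsubC_eq; rewrite -cB [RHS]Er.
  by have /monicP -> := char_poly_monic B; rewrite scale1r.
have : perm_eq (spectrum B) [tuple d i | i < n.+1].
  rewrite /spectrum perm_sort; apply: (perm_trans (perm_map _ perm_roots)).
  by rewrite -map_comp (eq_map (g := d)).
move=> /tuple_permP[s Es]; exists s => i.
rewrite /eigval Es (nth_map i) ?size_tuple ?size_enum_ord //=.
by rewrite tnth_mktuple nth_ord_enum.
Qed.

Lemma size_spectrum n (B : 'M[R[i]]_n.+1) : size (spectrum B) = n.+1.
Proof.
rewrite /spectrum size_sort size_map.
case: (closed_field_poly_normal _) => r /= Er.
have := size_char_poly B; rewrite Er.
have /monicP -> := char_poly_monic B; rewrite scale1r size_prod_XsubC.
by case.
Qed.

Lemma eigval_anti n (B : 'M[R[i]]_n.+1) i j : (i <= j)%N -> (j <= n)%N ->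
  eigval B j <= eigval B i.
Proof.
move=> ij jn.
have st : sorted (fun x y : R => y <= x) (spectrum B).
  by apply: sort_sorted => x y; exact: le_total.
have tr : transitive (fun x y : R => y <= x).
  by move=> y x z yx zy; exact: le_trans zy yx.
by have := sorted_leq_nth tr (@lexx _ R) 0 st i j; rewrite !inE !size_spectrum !ltnS;
   apply => //; exact: leq_trans jn.
Qed.

(** The translation by the diagonalizing matrix and its inverse are families of
    one element, so that the two free energies bound each other. *)
Lemma free_energy_eigval beta n (m : probability (borel_mx R n) R) theta (B : 'M[R[i]]_n.+1) :
  is_haar beta m -> 0 <= theta -> self_adjoint beta B ->
  free_energy beta m theta B = diag_energy beta m theta (fun i => eigval B i).
Proof.
move=> hm t0 Bs.
have [P [d PG BE]] := self_adjoint_diagonalization Bs.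
have PP := isom_groupK PG.
have [s Es] := eigval_diagonal PP BE.
have cornerE U : corner B U = corner (rdiag d) (U *m P ^t* ).
  by rewrite /corner BE adjM trmxCK !mulmxA.
have PaG := isom_group_conj PG.
have Bb : corner_bounded beta B.
  have [c Hc] := corner_bounded_rdiag beta d.
  exists c => U UG; rewrite cornerE; apply: Hc; exact: isom_group_mul UG PaG.
have db := corner_bounded_rdiag beta d.
have E : free_energy beta m theta B = diag_energy beta m theta d.
  apply/eqP; rewrite eq_le; apply/andP; split.
    have := @free_energy_cover _ _ _ _ hm theta B (rdiag d) 0 [:: P ^t*] t0 Bb db.
    rewrite /= ln1 !mulr0 !addr0; apply.
      by move=> V; rewrite inE => /eqP ->.
    by move=> U UG; exists (P ^t* ); rewrite ?inE // cornerE addr0.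
  have := @free_energy_cover _ _ _ _ hm theta (rdiag d) B 0 [:: P] t0 db Bb.
  rewrite /= ln1 !mulr0 !addr0; apply.
    by move=> V; rewrite inE => /eqP ->.
  by move=> U UG; exists P; rewrite ?inE // cornerE addr0 -mulmxA PP mulmx1.
rewrite E; apply/eqP; rewrite eq_le; apply/andP; split.
  by apply: (diag_energy_perm hm t0 (s := (s^-1)%g)) => i; rewrite Es permKV.
by apply: (diag_energy_perm hm t0 (s := s)).
Qed.

End eigenvalues.

(** * The Dudley distance and the counting of eigenvalues *)

Section dudley_bounds.
Context {R : realType}.

Lemma integral_nu_hat n (B : 'M[R[i]]_n.+1) (f : R -> R) :
  measurable_fun setT f -> (forall x, 0 <= f x) ->
  (\int[nu_hat B]_x (f x)%:E = (n.+1%:R^-1 * \sum_(i < n) f (eigval B i.+1))%:E)%E.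
Proof.
move=> mf f0.
have mf' : measurable_fun setT (fun x : measurableTypeR R => (f x)%:E).
  exact/measurable_EFinP.
have f0' (x : measurableTypeR R) : setT x -> (0 <= (f x)%:E)%E by rewrite lee_fin.
rewrite /nu_hat ge0_integral_mscale // ge0_integral_measure_sum //.
rewrite EFinM -sumEFin; congr (_ * _)%E; apply: eq_bigr => i _.
by rewrite integral_dirac // diracT mul1e.
Qed.

(** The weights 1/N of the two measures are cleared. *)
Lemma dudley_test n (B B' : 'M[R[i]]_n.+1) (f : R -> R) (e : R) :
  measurable_fun setT f -> (forall x, 0 <= f x <= 1) ->
  (forall x y, `|f x - f y| <= `|x - y|) ->
  (dudley (nu_hat B) (nu_hat B') <= e%:E)%E ->
  `|\sum_(i < n) f (eigval B i.+1) - \sum_(i < n) f (eigval B' i.+1)| <= n.+1%:R * e.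
Proof.
move=> mf f01 flip dle.
have f0 x : 0 <= f x by case/andP: (f01 x).
have : (`| \int[nu_hat B]_x (f x)%:E - \int[nu_hat B']_x (f x)%:E | <= e%:E)%E.
  apply: le_trans dle; apply: ereal_sup_ubound; exists f => //=; split.
    by move=> x; rewrite ger0_norm //; case/andP: (f01 x).
  move=> x y xy; rewrite normrM normfV ler_pdivrMr ?normr_gt0 ?subr_eq0 //.
  by rewrite mul1r.
have fin (X Y : \bar R) (a b : R) : X = a%:E -> Y = b%:E ->
    (`|X - Y| <= e%:E)%E -> `|a - b| <= e.
  by move=> -> ->; rewrite -EFinB abse_EFin lee_fin.
move=> /(fin _ _ _ _ (integral_nu_hat B mf f0) (integral_nu_hat B' mf f0)).
have N0 : 0 < n.+1%:R^-1 :> R by rewrite invr_gt0 ltr0n.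
rewrite -mulrBr normrM (gtr0_norm N0) => H.
by rewrite -[n.+1%:R]invrK ler_pdivlMl.
Qed.

(** A Lipschitz substitute for h times the indicator function of the half-line
    of x > t; the two agree outside the interval from t to t + h. *)
Definition ramp (t h x : R) : R := Num.min (Num.max (x - t) 0) h.

Lemma measurable_ramp t h : measurable_fun setT (ramp t h).
Proof.
apply: measurable_funS (measurableT) (@subsetT _ _) _.
apply: measurable_minr => //; apply: measurable_maxr => //.
exact: measurable_funB.
Qed.

Lemma ramp_bounds t h x : 0 <= h -> 0 <= ramp t h x <= h.
Proof.
move=> h0; rewrite /ramp ge_min lexx orbT andbT le_min h0 andbT.
by rewrite le_max lexx orbT.
Qed.

Lemma ramp_lipschitz t h x y : `|ramp t h x - ramp t h y| <= `|x - y|.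
Proof.
wlog xy : x y / x <= y => [H|].
  by have [/H//|/ltW /H] := leP x y; rewrite distrC [`|y - x|]distrC.
rewrite distrC [`|x - y|]distrC [leRHS]ger0_norm ?subr_ge0 // ler_norml /ramp.
have [hx|hx] := leP (x - t) 0; have [hy|hy] := leP (y - t) 0;
  rewrite /Num.min; do ?case: ifP; move=> *; lra.
Qed.

Lemma ramp_above t h x : 0 <= h -> t + h <= x -> ramp t h x = h.
Proof.
move=> h0 tx; rewrite /ramp; apply/min_idPr; rewrite le_max; apply/orP; left; lra.
Qed.

Lemma ramp_below t h x : 0 <= h -> x <= t -> ramp t h x = 0.
Proof.
move=> h0 xt; rewrite /ramp (max_idPr _) ?subr_le0 //.
exact/min_idPl.
Qed.

Lemma sum_ord_lt (n q : nat) : (q <= n)%N ->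
  \sum_(k < n) ((k < q)%N)%:R = q%:R :> R.
Proof.
move=> qn; transitivity (\sum_(k < n | (k < q)%N) 1 : R).
  by rewrite [RHS]big_mkcond /=; apply: eq_bigr => k _; case: ifP.
by rewrite -(big_ord_widen n (fun=> 1)) // sumr_const card_ord.
Qed.

Lemma dudley_ramp n (B B' : 'M[R[i]]_n.+1) (e h t : R) :
  0 <= h <= 1 -> (dudley (nu_hat B) (nu_hat B') <= e%:E)%E ->
  `|\sum_(i < n) ramp t h (eigval B i.+1) - \sum_(i < n) ramp t h (eigval B' i.+1)|
    <= n.+1%:R * e.
Proof.
move=> /andP[h0 h1]; apply: dudley_test (measurable_ramp t h) _ (@ramp_lipschitz t h).
by move=> x; have /andP[-> /le_trans ->] := ramp_bounds t x h0.
Qed.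

(** Otherwise the ramp at t = lambda_i(B') equals h at lambda_1, ..., lambda_(i+p)
    of B, whereas it vanishes at lambda_i, ..., lambda_n of B' and is at most h at
    the i - 1 remaining ones: the sums differ by at least (p + 1) h > N e. *)
Lemma eigval_shift n (B B' : 'M[R[i]]_n.+1) (e h : R) (p i : nat) : 0 < h ->
  (forall t, `|\sum_(i < n) ramp t h (eigval B i.+1) -
               \sum_(i < n) ramp t h (eigval B' i.+1)| <= n.+1%:R * e) ->
  n.+1%:R * e / h < p.+1%:R -> (0 < i)%N -> (i + p <= n)%N ->
  eigval B (i + p) <= eigval B' i + h.
Proof.
move=> h0 test hp i0 ip; rewrite leNgt; apply/negP => lt.
pose f := ramp (eigval B' i) h.
have h0' := ltW h0.
have := test (eigval B' i).
apply/negP; rewrite -ltNge.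
have s1 : (i + p)%:R * h <= \sum_(k < n) f (eigval B k.+1).
  rewrite -(sum_ord_lt ip) mulr_suml; apply: ler_sum => k _.
  have [ki|_] := ltnP k (i + p); last first.
    by rewrite mul0r; case/andP: (ramp_bounds (eigval B' i) (eigval B k.+1) h0').
  rewrite mul1r /f ramp_above // (le_trans (ltW lt)) //.
  by apply: eigval_anti.
have s2 : \sum_(k < n) f (eigval B' k.+1) <= i.-1%:R * h.
  have i1n : (i.-1 <= n)%N by rewrite (leq_trans (leq_pred i)) // (leq_trans _ ip) // leq_addr.
  rewrite -(sum_ord_lt i1n) mulr_suml; apply: ler_sum => k _.
  have [ki|ki] := ltnP k i.-1.
    by rewrite mul1r; case/andP: (ramp_bounds (eigval B' i) (eigval B' k.+1) h0').
  rewrite mul0r /f ramp_below // eigval_anti //.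
  by rewrite -(prednK i0) ltnS.
rewrite ltr_pdivrMr // in hp; apply: (lt_le_trans hp).
apply: le_trans (ler_norm _); apply: le_trans (lerB s1 s2).
rewrite -mulrBl ler_wpM2r // -natrB; last by rewrite (leq_trans (leq_pred i)) // leq_addr.
by rewrite ler_nat -{1}(prednK i0) addSn -addnS addKn.
Qed.

End dudley_bounds.

(** * Comparison of shifted spectra *)

Section comparison.
Context {R : realType} (beta n : nat) (m : probability (borel_mx R n) R).
Hypothesis hm : is_haar beta m.
Variable theta : R.
Hypothesis theta0 : 0 <= theta.
Local Notation F x := (diag_energy beta m theta (fun i : 'I_n.+1 => x (nat_of_ord i))).

(** Raise the top eigenvalue of x to the common value a, shift the others
    cyclically by p, and compare with y index by index: the indices i with
    i + p > n are the p exceptional ones. *)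
Lemma diag_energy_shift (x y : nat -> R) (delta h W : R) (p L : nat) :
  (0 < L)%N -> (p <= n)%N -> 0 <= h -> 0 <= delta -> 0 <= W ->
  (forall i, (i <= n)%N -> x i <= x 0%N) -> x 0%N <= y 0%N + delta ->
  (forall i, (0 < i)%N -> (i + p <= n)%N -> x (i + p)%N <= y i + h) ->
  (forall i, (i <= n)%N -> Num.max (x 0%N) (y 0%N) - y i <= W) ->
  F x <= F y + theta * (delta + h) + p%:R * step_cost n theta L W.
Proof.
move=> L0 pn h0 d0 W0 xtop xy0 xyp yW.
set a := Num.max (x 0%N) (y 0%N).
pose xa i := if i == 0%N then a else x i.
(* the cyclic shift by p of x_1, ..., x_n *)
pose z i := if i == 0%N then a else if (i + p <= n)%N then x (i + p)%N else x (i + p - n)%N.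
have Fxa : F x <= F xa.
  rewrite -[leRHS]addr0 -(mulr0 theta); apply: diag_energy_mono => // i.
  by rewrite addr0 /xa; case: eqP => [->|//]; rewrite le_max lexx.
(* the inverse of the shift, as a map on indices *)
pose sn (i : nat) := if i == 0%N then 0%N else if (i <= p)%N then (i + n - p)%N else (i - p)%N.
have snn i : (i <= n)%N -> (sn i <= n)%N.
  by rewrite /sn; case: eqP => // _; case: (leqP i p) => ? ?; lia.
pose s (i : 'I_n.+1) : 'I_n.+1 := inord (sn i).
have sE i : s i = sn i :> nat by rewrite inordK // ltnS snn // -ltnS.
have s_inj : injective s.
  move=> i j /(congr1 (@nat_of_ord _)); rewrite !sE => E; apply/val_inj => /=.
  have := ltn_ord i; have := ltn_ord j; move: E; rewrite /sn !ltnS.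
  by case: eqP => ?; case: eqP => ?; case: (leqP i p) => ?; case: (leqP j p) => ? ? ? ?; lia.
have Fz : F xa <= F z.
  apply: (diag_energy_perm hm theta0 (s := perm s_inj)) => i; rewrite permE sE /xa /z /sn.
  have := ltn_ord i; rewrite ltnS => i_n.
  have [//|i0] := eqVneq (nat_of_ord i) 0%N; case: (leqP i p) => ip.
    rewrite ifF; last by apply: negbTE; lia.
    rewrite ifF; last by apply: negbTE; lia.
    by congr x; lia.
  rewrite ifF; last by apply: negbTE; lia.
  rewrite ifT; last by lia.
  by congr x; lia.
pose J := [seq (inord (n - k) : 'I_n.+1) | k <- iota 0 p].
have JE k : (n - k < n.+1)%N by rewrite ltnS leq_subr.
have uJ : uniq J.
  rewrite map_inj_in_uniq ?iota_uniq // => k l; rewrite !mem_iota !add0n => /andP[_ kp] /andP[_ lp].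
  by move=> /(congr1 (@nat_of_ord _)); rewrite !inordK // => ?; lia.
have J0 : ord0 \notin J.
  apply/negP => /mapP[k]; rewrite mem_iota add0n => /andP[_ kp].
  by move=> /(congr1 (@nat_of_ord _)); rewrite inordK //= => ?; lia.
have JC (i : 'I_n.+1) : i \notin J -> (i + p <= n)%N.
  apply: contraNT; rewrite -ltnNge => ip; have i_n := ltn_ord i.
  apply/mapP; exists (n - i)%N; first by rewrite mem_iota; lia.
  by apply/val_inj; rewrite /= inordK //; lia.
have za i : (i <= n)%N -> z i <= a.
  move=> i_n; rewrite /z; case: eqP => // _.
  by case: (leqP (i + p) n) => ip; rewrite le_max xtop //; lia.
have Fs := @diag_energy_steps _ beta n m hm theta theta0 (fun i => z (nat_of_ord i))
  (fun i => y (nat_of_ord i)) J L W L0 W0 uJ J0.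
have {}Fs : F z <= diag_energy beta m theta (override (fun i : 'I_n.+1 => z i) (fun i => y i) J)
    + p%:R * step_cost n theta L W.
  rewrite -[p in p%:R](size_iota 0 p) -(size_map (fun k => (inord (n - k) : 'I_n.+1)) (iota 0 p)).
  apply: Fs => j _ /=.
    by apply: za; rewrite -ltnS.
  by rewrite /z eqxx; apply: yW; rewrite -ltnS.
have Fm : diag_energy beta m theta (override (fun i : 'I_n.+1 => z i) (fun i => y i) J)
    <= F y + theta * (delta + h).
  apply: diag_energy_mono => // i; rewrite /override; case: ifPn => [_|/JC ip].
    by rewrite lerDl addr_ge0.
  rewrite /z; case: eqP => [->|/eqP i0].
    rewrite /a ge_max; apply/andP; split; first by rewrite addrA (le_trans xy0) // lerDl.
    by rewrite lerDl addr_ge0.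
  by rewrite ip (le_trans (xyp _ _ ip)) ?lt0n // lerD2l lerDr.
apply: (le_trans Fxa); apply: (le_trans Fz); apply: (le_trans Fs).
exact: lerD Fm (lexx _).
Qed.

End comparison.

(** * Quantitative comparison and asymptotics *)

Section asymptotics.
Context {R : realType}.

(** The threshold solves N^-s = eps. *)
Lemma near_powRN_le (s eps : R) : 0 < s -> 0 < eps ->
  \forall n \near \oo, (n.+1%:R : R) `^ (- s) <= eps.
Proof.
move=> s0 e0; exists (Num.truncn (eps `^ (- s^-1))) => // n /= hn.
have x0 : 0 < eps `^ (- s^-1) by rewrite powR_gt0.
have N0 : 0 < n.+1%:R :> R by rewrite ltr0n.
have le1 : eps `^ (- s^-1) <= n.+1%:R.
  by rewrite (le_trans (ltW (truncnS_gt _))) // ler_nat ltnS.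
rewrite powRN -[leRHS]invrK lef_pV2 ?posrE ?invr_gt0 ?powR_gt0 //.
have -> : eps^-1 = (eps `^ (- s^-1)) `^ s.
  by rewrite -powRrM mulNr mulVf ?gt_eqF // powR_inv1 // ltW.
by apply: ge0_ler_powR => //; rewrite ?nnegrE; exact: ltW.
Qed.

(** log N grows more slowly than N^(kappa/2): multiplying by one of the two
    factors q of N^-kappa = q^2 already makes the cost of the net bounded. *)
Lemma net_cost_le (N : nat) (theta M kappa q : R) : (0 < N)%N -> 0 <= theta -> 0 <= M ->
  0 < kappa -> q = N%:R `^ (- (kappa / 2)) ->
  q * (theta * (M * (2 / N%:R)) + ln (2 * N.*2.+1 ^ 2)%:R)
    <= theta * (M * 2) + ln 18 + 4 / kappa.
Proof.
move=> N0 t0 M0 k0 qE.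
have N1 : 1 <= N%:R :> R by rewrite ler1n.
have N0' : 0 < N%:R :> R by rewrite ltr0n.
have q0 : 0 < q by rewrite qE powR_gt0.
have q1 : q <= 1.
  have : N%:R `^ 0 <= N%:R `^ (kappa / 2) :> R by rewrite ler_powR // divr_ge0 // ltW.
  by rewrite powRr0 qE powRN invf_le1 // powR_gt0.
have l18 : 0 <= ln 18 :> R by rewrite ln_ge0 // ler1n.
(* 2 N + 1 <= 3 N, whence the constant 18 = 2 * 3 ^ 2 *)
have lnle : ln (2 * N.*2.+1 ^ 2)%:R <= ln 18 + 2 * ln N%:R :> R.
  have -> : 2 * ln N%:R = ln (N%:R ^+ 2) :> R by rewrite lnXn // mulr_natl.
  rewrite -lnM ?posrE ?exprn_gt0 ?ltr0n // ler_ln ?posrE ?mulr_gt0 ?exprn_gt0 ?ltr0n //.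
  by rewrite -natrX -natrM ler_nat; nia.
(* log applied to N^(kappa/2) = 1/q, with log x <= x *)
have qln : q * ln N%:R <= 2 / kappa.
  have h : kappa / 2 * ln N%:R <= q^-1.
    rewrite -ln_powR qE powRN invrK ltW // ln_sublinear // powR_gt0 //.
  have k2 : 0 < kappa / 2 by rewrite divr_gt0.
  rewrite -(ler_pM2l k2) mulrCA (_ : kappa / 2 * (2 / kappa) = 1); last by field; rewrite gt_eqF.
  by rewrite -ler_pdivlMl // mulr1.
have Ninv : N%:R^-1 <= 1 :> R by rewrite invf_le1.
have A : theta * (M * (2 / N%:R)) <= theta * (M * 2).
  by rewrite ler_wpM2l // ler_wpM2l // -[leRHS]mulr1 ler_wpM2l.
have A0 : 0 <= theta * (M * 2) by rewrite !mulr_ge0.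
have B1 : q * (theta * (M * (2 / N%:R))) <= theta * (M * 2).
  apply: le_trans A; rewrite -[leRHS]mul1r ler_wpM2r //.
  by rewrite !mulr_ge0 // invr_ge0 ltW.
have B2 : q * ln (2 * N.*2.+1 ^ 2)%:R <= ln 18 + 4 / kappa.
  apply: (@le_trans _ _ (q * (ln 18 + 2 * ln N%:R))); first by rewrite ler_pM2l.
  rewrite mulrDr lerD //; first by rewrite -[leRHS]mul1r ler_wpM2r.
  rewrite mulrCA (_ : 4 / kappa = 2 * (2 / kappa)); last by field; rewrite gt_eqF.
  by rewrite ler_pM2l.
by rewrite mulrDr -addrA lerD.
Qed.

Lemma norm_eigval_le n (B : 'M[R[i]]_n.+1) (i : nat) : (i <= n)%N ->
  `|eigval B i| <= norm_oo B.
Proof.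
move=> i_n; rewrite /norm_oo ler_norml; apply/andP; split.
  rewrite lerNl (@le_trans _ _ (- eigval B n)) ?lerN2 ?eigval_anti //.
  by rewrite le_max -(normrN (eigval B n)) ler_norm orbT.
by rewrite (@le_trans _ _ (eigval B 0)) ?eigval_anti // le_max ler_norm.
Qed.

(** The net has mesh 1/N: its size is then polynomial in N, while the loss due to
    the mesh, summed over at most N e / h replacements, is only O(e / (N h)). *)
Lemma free_energy_compare (beta n : nat) (m : probability (borel_mx R n) R)
    (theta delta h M e : R) (B B' : 'M[R[i]]_n.+1) :
  is_haar beta m -> 0 <= theta -> self_adjoint beta B -> self_adjoint beta B' ->
  norm_oo B <= M -> norm_oo B' <= M -> 0 < h -> 0 <= delta -> 0 <= e < h ->
  (forall t, `|\sum_(i < n) ramp t h (eigval B i.+1) -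
               \sum_(i < n) ramp t h (eigval B' i.+1)| <= n.+1%:R * e) ->
  eigval B 0 <= eigval B' 0 + delta ->
  free_energy beta m theta B <= free_energy beta m theta B' + theta * (delta + h) +
    e / h * (theta * (2 * M * (2 / n.+1%:R)) + ln (2 * n.+1.*2.+1 ^ 2)%:R).
Proof.
move=> hm t0 Bs Bs' BM BM' h0 d0 /andP[e0 eh] test top.
rewrite !free_energy_eigval //.
have N0 : 0 < n.+1%:R :> R by rewrite ltr0n.
have M0 : 0 <= M by rewrite (le_trans _ BM) // le_max normr_ge0.
set p := Num.truncn (n.+1%:R * e / h).
have x0 : 0 <= n.+1%:R * e / h by rewrite divr_ge0 ?mulr_ge0 // ltW.
have pn : (p <= n)%N.
  by rewrite -ltnS truncn_lt_nat // ltr_pdivrMr // ltr_pM2l.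
have bnd (i : nat) : (i <= n)%N -> - M <= eigval B' i.
  by move=> /(norm_eigval_le B') H; have := le_trans H BM'; rewrite ler_norml => /andP[].
have topM : Num.max (eigval B 0) (eigval B' 0) <= M.
  rewrite ge_max; apply/andP; split.
    exact: le_trans (ler_norm _) (le_trans (norm_eigval_le B (leq0n n)) BM).
  exact: le_trans (ler_norm _) (le_trans (norm_eigval_le B' (leq0n n)) BM').
have := @diag_energy_shift _ beta n m hm theta t0 (eigval B) (eigval B') delta h (2 * M) p n.+1
  isT pn (ltW h0) d0.
move=> /(_ _ _ top) H; apply: le_trans (H _ _ _ _) _.
- by rewrite mulr_ge0.
- by move=> i i_n; exact: eigval_anti.
- move=> i i0 ip; apply: (eigval_shift h0 test) => //; exact: truncnS_gt.
- by move=> i /bnd yi; rewrite mulr_natl mulr2n (lerD topM) // lerNl.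
rewrite lerD2l.
have c0 : 0 <= ln (2 * n.+1.*2.+1 ^ 2)%:R :> R by rewrite ln_ge0 // ler1n muln_gt0 expn_gt0.
have sE : n.+1%:R * step_cost n theta n.+1 (2 * M) =
    theta * (2 * M * (2 / n.+1%:R)) + ln (2 * n.+1.*2.+1 ^ 2)%:R.
  rewrite /step_cost mulrDr [X in _ + X]mulrA mulfV ?gt_eqF // mul1r; congr (_ + _).
  by move: (n.+1%:R) N0 => N N0; field; rewrite gt_eqF.
rewrite -sE.
have s0 : 0 <= step_cost n theta n.+1 (2 * M).
  rewrite -(pmulr_rge0 _ N0) sE addr_ge0 // !mulr_ge0 // invr_ge0 ltW //.
have -> : e / h * (n.+1%:R * step_cost n theta n.+1 (2 * M)) =
  n.+1%:R * e / h * step_cost n theta n.+1 (2 * M).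
  by move: (step_cost _ _ _ _) => c; ring.
by rewrite ler_wpM2r //; case/andP: (truncn_itv x0).
Qed.

End asymptotics.

Theorem proposition2p1 (R : realType) (beta : nat)
    (hbeta : beta = 1%N \/ beta = 2%N)
    (m : forall n : nat, probability (borel_mx R n) R)
    (hm : forall n : nat, is_haar beta (m n))
    (theta kappa : R) (htheta : 0 < theta) (hkappa : 0 < kappa < 2^-1) :
  exists g : R -> R,
    (forall x, 0 <= x -> 0 <= g x) /\
    (g x @[x --> 0^'+] --> (0 : R)) /\
    forall (delta : R) (B B' : forall n : nat, 'M[R[i]]_n.+1),
      0 < delta ->
      (forall n, self_adjoint beta (B n)) ->
      (forall n, self_adjoint beta (B' n)) ->
      has_ubound (range (fun n => norm_oo (B n))) ->
      has_ubound (range (fun n => norm_oo (B' n))) ->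
      \forall n \near \oo,
        (dudley (nu_hat (B n)) (nu_hat (B' n)) <=
           ((n.+1%:R : R) `^ (- kappa))%:E)%E ->
        `|eigval (B n) 0 - eigval (B' n) 0| <= delta ->
        `| (n.+1%:R)^-1 * ln (spherical_integral beta (m n) theta (B n))
           - (n.+1%:R)^-1 * ln (spherical_integral beta (m n) theta (B' n)) |
          <= g delta.
Proof.
have k0 : 0 < kappa by case/andP: hkappa.
have t0 := ltW htheta.
have c0 : 0 <= 2 * theta + 1 by rewrite addr_ge0 // mulr_ge0.
exists (fun x => (2 * theta + 1) * x); split; first by move=> x; exact: mulr_ge0.
split.
  rewrite -[X in _ --> X](mulr0 (2 * theta + 1)); apply: cvgMr.
  exact: (cvg_at_right_filter (@cvg_id _ _)).
move=> delta B B' d0 Bs Bs' [M1 HM1] [M2 HM2].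
pose M := Num.max M1 M2.
have BM n : norm_oo (B n) <= M by rewrite le_max HM1 //; exists n.
have BM' n : norm_oo (B' n) <= M by rewrite le_max HM2 ?orbT //; exists n.
have M0 : 0 <= M by rewrite (le_trans _ (BM 0%N)) // le_max normr_ge0.
(* the cap at 1 makes the ramps admissible test functions *)
pose h := Num.min delta 1.
have h0 : 0 < h by rewrite lt_min d0 ltr01.
have h1 : h <= 1 by rewrite ge_min lexx orbT.
have hd : h <= delta by rewrite ge_min lexx.
pose C := theta * (2 * M * 2) + ln 18 + 4 / kappa.
have C0 : 0 < C.
  rewrite ltr_wpDl ?divr_gt0 // addr_ge0 ?ln_ge0 ?ler1n // !mulr_ge0 //.
(* q <= h / 2 ensures N^-kappa < h, hence p <= n; q <= delta h / C bounds the
   cost of the p replacements by delta *)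
pose eps := Num.min (h / 2) (delta * h / C).
have eps0 : 0 < eps by rewrite lt_min !divr_gt0 ?mulr_gt0.
have := near_powRN_le (divr_gt0 k0 (ltr0n R 2)) eps0.
apply: filterS => n; set q := _ `^ _ => qeps dud top.
have q0 : 0 < q by rewrite powR_gt0 // ltr0n.
have qh : q <= h / 2 by rewrite (le_trans qeps) // ge_min lexx.
have qd : q <= delta * h / C by rewrite (le_trans qeps) // ge_min lexx orbT.
have qlth : q < h by rewrite (le_lt_trans qh) // ltr_pdivrMr // mulr_natr mulr2n ltrDl.
have q1 : q <= 1 by rewrite (le_trans (ltW qlth)).
have eE : n.+1%:R `^ (- kappa) = q * q.
  by rewrite /q -powRD ?pnatr_eq0 ?implybT //; congr (_ `^ _); field.
rewrite eE in dud.
have eh : 0 <= q * q < h.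
  by rewrite mulr_ge0 ?ltW //= (le_lt_trans _ qlth) // ler_piMl // ltW.
have h01 : 0 <= h <= 1 by rewrite ltW.
have cost := net_cost_le (N := n.+1) isT t0 (mulr_ge0 (ler0n R 2) M0) k0 (erefl q).
set T := theta * _ + ln _%:R in cost.
have err : theta * (delta + h) + q * q / h * T <= (2 * theta + 1) * delta.
  have A : theta * (delta + h) <= 2 * theta * delta.
    by rewrite -mulrA mulrCA ler_wpM2l // mulr_natl mulr2n lerD2l.
  have A' : q * q / h * T <= delta.
    rewrite (_ : q * q / h * T = q * (q * T) / h); last by field; rewrite gt_eqF.
    rewrite ler_pdivrMr //; apply: (@le_trans _ _ (q * C)).
      by rewrite ler_wpM2l // ltW.
    by rewrite -ler_pdivlMr.
  by rewrite mulrDl mul1r; exact: lerD.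
have test t := dudley_ramp t h01 dud.
have top1 : eigval (B n) 0 <= eigval (B' n) 0 + delta by exact: ler_distlDr top.
have top2 : eigval (B' n) 0 <= eigval (B n) 0 + delta.
  by apply: ler_distlDr; rewrite distrC.
have test' t : `|\sum_(i < n) ramp t h (eigval (B' n) i.+1) -
    \sum_(i < n) ramp t h (eigval (B n) i.+1)| <= n.+1%:R * (q * q).
  by rewrite distrC.
have I1 := free_energy_compare (hm n) t0 (Bs n) (Bs' n) (BM n) (BM' n) h0 (ltW d0) eh test top1.
have I2 := free_energy_compare (hm n) t0 (Bs' n) (Bs n) (BM' n) (BM n) h0 (ltW d0) eh test' top2.
rewrite -/T -addrA in I1; rewrite -/T -addrA in I2.
suff goal : `|free_energy beta (m n) theta (B n) - free_energy beta (m n) theta (B' n)|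
    <= (2 * theta + 1) * delta by exact: goal.
move: (free_energy _ _ _ (B n)) (free_energy _ _ _ (B' n)) I1 I2 => x y I1 I2.
rewrite ler_norml; apply/andP; split.
  rewrite lerNl opprB lerBlDl; exact: le_trans I2 (lerD (lexx _) err).
rewrite lerBlDl; exact: le_trans I1 (lerD (lexx _) err).
Qed.
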